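(* Let $S$, $p$, $V=T_pS$, $m=\dim V$, $U$, $Y$, $\mathcal A$, $L=d\mathcal A_p$, $E$, $\Theta_{\boldsymbol\ell}$, $\nu_E(p)$ and $\rho_p$ be as in the context, and assume that $\rho_p:E\to L(V)^*$, $\rho_p(\ell)=\ell|_{L(V)}$, is surjective. Then the following hold. (1) A finite infinitesimally complete admissible scalar family at $p$ (that is, some $N\in\mathbb N_0$ and $\boldsymbol\ell\in E^N$ with $d\Theta_{\boldsymbol\ell,p}$ injective) exists if and only if $L$ is injective. (2) If $L$ is injective, then $\nu_E(p)=m=\dim T_pS$. In particular, if $m=0$, then the empty scalar family is infinitesimally complete and $\nu_E(p)=0$. (3) Suppose $L$ is injective and $N\ge m$. Then $\mathcal C_{p,N}:=\{\boldsymbol\ell\in E^N: d\Theta_{\boldsymbol\ell,p}\text{ is injective}\}$ is open and dense in $E^N$ with respect to its Banach-space norm topology. (4) Suppose $m\ge1$, $N=m$ and $\boldsymbol\ell\in\mathcal C_{p,m}$. Then $\Theta_{\boldsymbol\ell}$ is a local $C^1$-diffeomorphism at $p$. Consequently, there exists an open neighbourhood $U_0\subset U$ of $p$ such that $\Theta_{\boldsymbol\ell}^{-1}(\Theta_{\boldsymbol\ell}(p))\cap U_0=\{p\}$. (5) Equip $S$ with an auxiliary Riemannian metric $g^S$ with associated Riemannian distance $d_S$. Under the hypotheses $m\ge 1$, $N=m$, $\boldsymbol\ell\in\mathcal C_{p,m}$ of (4), the neighbourhood $U_0$ in (4) may (after shrinking if necessary) be chosen so that there exist constants $0<c\le C<\infty$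 with $$c\,d_S(p_1,p_2)\le\left|\Theta_{\boldsymbol\ell}(p_1)-\Theta_{\boldsymbol\ell}(p_2)\right|\le C\,d_S(p_1,p_2)\qquad\text{for all }p_1,p_2\in U_0.$$ Thus every minimal infinitesimally complete admissible family induces a local bi-Lipschitz chart on $S$ near $p$.
   Context: $S$ is a smooth finite-dimensional manifold (parameterizing a smooth family of normalized Einstein metrics on a fixed manifold; only the manifold $S$ and the following data are used). Fix $p\in S$, put $V:=T_pS$, $m:=\dim V$. Let $U\subset S$ be an open neighbourhood of $p$, $Y$ a real Banach space, $\mathcal A:U\to Y$ a $C^1$ map (the master observation map) and $L:=d\mathcal A_p:V\to Y$. Let $E$ be a Banach space with a continuous injective linear map $\iota:E\to Y^*$; identify $E$ with its image, and call its elements admissible scalar postprocessings. For $\boldsymbol\ell=(\ell_1,\dots,\ell_N)\in E^N$ define $\Theta_{\boldsymbol\ell}:=(\ell_1\circ\mathcal A,\dots,\ell_N\circ\mathcal A):U\to\mathbb R^N$, a $C^1$ map with $d\Theta_{\boldsymbol\ell,p}(v)=(\ell_1(Lv),\dots,\ell_N(Lv))$. The family $\boldsymbol\ell$ is called infinitesimally complete (at $p$) if $d\Theta_{\boldsymbol\ell,p}$ is injective. For $N=0$, use the conventions $E^0=\{()\}$, $\mathbb R^0=\{0\}$. The admissible scalar probe number $\nu_E(p)$ is the minimum of all $N\in\mathbb N_0$ for which there is $\boldsymbol\ell\in E^N$ with $d\Theta_{\boldsymbol\ell,p}$ injective, and $\nu_E(p):=+\infty$ if no such $N$ exists. The finite-dimensional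 subspace $L(V)\subset Y$ carries the norm induced from $Y$, and $L(V)^*$ the dual norm; $\rho_p:E\to L(V)^*$ is the continuous linear restriction map $\rho_p(\ell)=\ell|_{L(V)}$. *)

(* Defs.v *)
From HB Require Import structures.
From mathcomp Require Import all_boot all_order all_algebra.
From mathcomp Require Import all_classical all_reals all_analysis.

Set Implicit Arguments.
Unset Strict Implicit.
Unset Printing Implicit Defensive.

Import Order.TTheory GRing.Theory Num.Theory.
Import numFieldNormedType.Exports.

Local Open Scope classical_set_scope.
Local Open Scope ring_scope.

(* [Ck k A f] is only used for [A] open and [V] finite-dimensional. There,
   continuity of x |-> 'd f x in operator norm is the same as continuity of
   x |-> 'd f x v for every v, so the recursion below is the usual one. *)
Fixpoint Ck (R : realType) (V W : normedModType R) (k : nat) (A : set V)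
    (f : V -> W) : Prop :=
  if k is k'.+1 then
    (forall x, A x -> differentiable f x) /\ (forall v, Ck k' A ('D_v f))
  else forall x, A x -> {for x, continuous f}.

Definition smooth_on (R : realType) (V W : normedModType R) (A : set V)
    (f : V -> W) : Prop := forall k, Ck k A f.

(* [cinv] is a total function; it is meaningful only on [cmap @` dom]. *)
Record chart (R : realType) (n : nat) (T : topologicalType) := Chart {
  dom : set T;
  cmap :> T -> 'rV[R]_n;
  cinv : 'rV[R]_n -> T;
  open_dom : open dom;
  open_cimg : open (cmap @` dom);
  cmapK : forall q, dom q -> cinv (cmap q) = q;
  continuous_cmap : {within dom, continuous cmap};
  continuous_cinv : {within cmap @` dom, continuous cinv} }.

(* The atlas need not be maximal: the tangent spaces, the C^1 maps and the
   smooth metrics defined below are the same for any two compatible atlases. *)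
Record manifold (R : realType) (n : nat) := Manifold {
  carrier :> topologicalType;
  manifold_hausdorff : hausdorff_space carrier;
  manifold_second_countable : @second_countable carrier;
  atlas : set (chart R n carrier);
  atlas_cover : forall q, exists2 c, atlas c & dom c q;
  atlas_smooth : forall c d, atlas c -> atlas d ->
    smooth_on (c @` (dom c `&` dom d)) (d \o cinv c) }.

Section Manifold.
Context (R : realType) (n : nat) (S : manifold R n).
Implicit Types (q : S) (c d : chart R n S).

Definition chart_around q c : Prop := atlas c /\ dom c q.

Definition chart_at q : chart R n S := s2val (cid2 (atlas_cover q)).

Lemma chart_atP q : chart_around q (chart_at q).
Proof. by rewrite /chart_at; case: cid2. Qed.

(* A tangent vector at [q] is the family of its coordinate vectors in the
   charts around [q], any two being exchanged by the differential of the
   transition map. It is 0 on the irrelevant charts. *)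
Definition tangent_family q (X : chart R n S -> 'rV[R]_n) : Prop :=
  (forall c, ~ chart_around q c -> X c = 0) /\
  (forall c d, chart_around q c -> chart_around q d ->
     X d = 'd (d \o cinv c) (c q) (X c)).

Definition tangent_pred q : {pred chart R n S -> 'rV[R]_n} :=
  fun X => `[< tangent_family q X >].

Record tangent q := Tangent {
  coords :> chart R n S -> 'rV[R]_n;
  coordsP : coords \in tangent_pred q }.

HB.instance Definition _ q := [isSub for @coords q].
HB.instance Definition _ q := [Choice of tangent q by <:].

Lemma tangent_submod q : GRing.submod_closed (tangent_pred q).
Proof.
split.
  apply/asboolP; split=> // c d _ _.
  by rewrite /= linear0.
move=> a X Y /asboolP[X0 XE] /asboolP[Y0 YE]; apply/asboolP; split.
  move=> c qc.
  by rewrite fctE (Y0 c)// addr0 -[X in X = _]/(a *: X c) X0// scaler0.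
move=> c d qc qd.
rewrite -[LHS]/(a *: X d + Y d) -[X in 'd _ _ X]/(a *: X c + Y c).
by rewrite linearP -XE// -YE.
Qed.

HB.instance Definition _ q :=
  GRing.isSubmodClosed.Build R _ (tangent_pred q) (tangent_submod q).
HB.instance Definition _ q := [SubChoice_isSubLmodule of tangent q by <:].

Lemma near_eq_differentiable (V W : normedModType R) (f g : V -> W) (x : V) :
  (\forall y \near x, f y = g y) -> differentiable f x ->
  differentiable g x /\ 'd g x = 'd f x :> (V -> W).
Proof.
move=> fg df.
have gE : g \o shift x = cst (g x) + 'd f x +o_ 0 id.
  rewrite -(nbhs_singleton fg).
  apply/eqaddoP => e e0.
  have /eqaddoP dfE := diff_locally df.
  have {dfE} := dfE e e0.
  have fg0 : \forall y \near (0 : V), f (y + x) = g (y + x).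
    by move: fg; rewrite (near_shift 0) subr0.
  by apply: filterS2 fg0 => y /= fgy; rewrite !fctE /= fgy.
have dE := diff_unique (diff_continuous df) gE.
by split=> //; apply/diff_locallyP; rewrite dE; split=> //; exact: diff_continuous.
Qed.

Lemma diff_comp_at (V1 V2 V3 : normedModType R) (f : V1 -> V2) (g : V2 -> V3)
    (x : V1) (y : V2) : f x = y -> differentiable f x -> differentiable g y ->
  differentiable (g \o f) x /\ 'd (g \o f) x = 'd g y \o 'd f x :> (V1 -> V3).
Proof.
by move=> <- df dg; split; [exact: differentiable_comp|exact: diff_comp].
Qed.

Lemma chart_near c q (O : set S) : dom c q -> open O -> O q ->
  \forall y \near c q, c (cinv c y) = y /\ O (cinv c y).
Proof.
move=> qc oO Oq.
have cqc : (c @` dom c) (c q) by exists q.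
have := @continuous_cinv _ _ _ c.
rewrite continuous_open_subspace; last exact: open_cimg.
move=> /(_ (c q)); rewrite inE => /(_ cqc) cc.
have nO : nbhs (cinv c (c q)) O by rewrite cmapK//; exact: open_nbhs_nbhs.
near=> y; split; last by near: y; exact: (cc _ nO).
have [q' q'c <-] : (c @` dom c) y.
  by near: y; apply: open_nbhs_nbhs; split => //; exact: open_cimg.
by rewrite cmapK.
Unshelve. all: by end_near. Qed.

Lemma transition_differentiable q c d :
  chart_around q c -> chart_around q d -> differentiable (d \o cinv c) (c q).
Proof.
move=> [ac qc] [ad qd]; have [+ _] := atlas_smooth ac ad 1.
by apply; exists q.
Qed.

Lemma transition_comp q c d e :
  chart_around q c -> chart_around q d -> chart_around q e ->
  'd (e \o cinv c) (c q) = 'd (e \o cinv d) (d q) \o 'd (d \o cinv c) (c q)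
    :> ('rV_n -> 'rV_n).
Proof.
move=> qc qd qe.
have E : (d \o cinv c) (c q) = d q by rewrite /= cmapK//; case: qc.
have dd := transition_differentiable qc qd.
have de := transition_differentiable qd qe.
have [dde <-] := diff_comp_at E dd de.
have /near_eq_differentiable : \forall y \near c q,
    ((e \o cinv d) \o (d \o cinv c)) y = (e \o cinv c) y.
  near=> y; rewrite /= cmapK//.
  by near: y; apply: filterS (chart_near qc.2 (@open_dom _ _ _ d) qd.2) => y [].
by move=> /(_ dde) [_].
Unshelve. all: by end_near. Qed.

Lemma transition_id q c : dom c q ->
  'd (c \o cinv c) (c q) = id :> ('rV_n -> 'rV_n).
Proof.
move=> qc.
have E : \forall y \near c q, id y = (c \o cinv c) y.
  by apply: filterS (chart_near qc openT I) => y [].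
by have [//|_ ->] := near_eq_differentiable E; rewrite diff_val.
Qed.

(* The tangent vector at [q] whose coordinate vector in the chart [c] is [u]. *)
Definition tvec q c (u : 'rV[R]_n) : tangent q :=
  insubd 0 (fun d => if `[< chart_around q d >]
                     then 'd (d \o cinv c) (c q) u else 0).

Lemma tvecE q c u d : chart_around q c -> chart_around q d ->
  tvec q c u d = 'd (d \o cinv c) (c q) u.
Proof.
move=> qc qd; have fam : (fun e => if `[< chart_around q e >]
    then 'd (e \o cinv c) (c q) u else 0) \in tangent_pred q.
  apply/asboolP; split=> [e qe|e f qe qf]; first by rewrite asboolF.
  rewrite (asboolT qe) (asboolT qf).
  exact: (congr1 (fun h => h u) (transition_comp qc qe qf)).
by rewrite /tvec -[coords _]/(val _) insubdK// asboolT.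
Qed.

Lemma tvecK q c : chart_around q c -> cancel (tvec q c) (fun X : tangent q => X c).
Proof. by move=> qc u /=; rewrite tvecE// transition_id//; case: qc. Qed.

Lemma coordsK q c : chart_around q c -> cancel (fun X : tangent q => X c) (tvec q c).
Proof.
move=> qc X; apply: val_inj; apply/funext => d /=.
have /asboolP[X0 XE] := coordsP X.
have [qd|nqd] := pselect (chart_around q d); first by rewrite tvecE// -XE.
have /asboolP[t0 _] := coordsP (tvec q c (X c)).
by rewrite (X0 d)//; exact: t0.
Qed.

Lemma tangent_vector_axiom q : Vector.axiom n (tangent q).
Proof.
exists (fun X : tangent q => X (chart_at q)); first by [].
exists (tvec q (chart_at q)).
- exact: (coordsK (chart_atP q)).
- exact: (tvecK (chart_atP q)).
Qed.

HB.instance Definition _ q :=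
  Lmodule_hasFinDim.Build R (tangent q) (tangent_vector_axiom q).

Lemma dim_tangent q : \dim {: tangent q} = n.
Proof. exact: dimvf. Qed.

Definition C1_on (W : normedModType R) (O : set S) (f : S -> W) : Prop :=
  forall c, atlas c -> Ck 1 (c @` (O `&` dom c)) (f \o cinv c).

(* As for [Ck], only used for [V] finite-dimensional and [O] open. *)
Definition C1_into (V : normedModType R) (O : set V) (h : V -> S) : Prop :=
  (forall x, O x -> {for x, continuous h}) /\
  (forall c, atlas c -> Ck 1 (O `&` h @^-1` dom c) (c \o h)).

(* The differential of [f] at [q]; it does not depend on the chart used, see
   [mdiffE]. *)
Definition mdiff (W : normedModType R) (f : S -> W) q (X : tangent q) : W :=
  'd (f \o cinv (chart_at q)) (chart_at q q) (X (chart_at q)).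

Lemma mdiffE (W : normedModType R) (O : set S) (f : S -> W) q (X : tangent q) c :
  O q -> C1_on O f -> chart_around q c ->
  mdiff f X = 'd (f \o cinv c) (c q) (X c).
Proof.
move=> Oq fC1 qc; rewrite /mdiff; have qa := chart_atP q.
move: (chart_at q) qa => a qa.
have df : differentiable (f \o cinv c) (c q).
  by have [+ _] := fC1 c qc.1; apply; exists q => //; split=> //; exact: qc.2.
have E : (c \o cinv a) (a q) = c q by rewrite /= cmapK//; case: qa.
have [dfa dE] := diff_comp_at E (transition_differentiable qa qc) df.
have nE : \forall y \near a q,
    ((f \o cinv c) \o (c \o cinv a)) y = (f \o cinv a) y.
  near=> y; rewrite /= cmapK//.
  by near: y; apply: filterS (chart_near qa.2 (@open_dom _ _ _ c) qc.2) => y [].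
have [_ nd] := near_eq_differentiable nE dfa.
have /asboolP[_ XE] := coordsP X.
have -> := XE a c qa qc.
exact: (congr1 (fun h => h (X a)) (etrans nd dE)).
Unshelve. all: by end_near. Qed.

Lemma mdiff_linear (W : normedModType R) (f : S -> W) q :
  linear (@mdiff W f q).
Proof.
move=> a X Y; rewrite /mdiff -linearP.
by congr ('d _ _ _).
Qed.

Definition C1_diffeo_on k (O : set S) (f : S -> 'rV[R]_k) : Prop :=
  [/\ C1_on O f, open (f @` O) &
      exists2 h : 'rV[R]_k -> S,
        forall q, O q -> h (f q) = q & C1_into (f @` O) h].

Definition local_C1_diffeo_at k (O : set S) (f : S -> 'rV[R]_k) q : Prop :=
  exists O0 : set S, [/\ open O0, O0 q, O0 `<=` O & C1_diffeo_on O0 f].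

Record riemannian_metric := RiemannianMetric {
  rmetric :> forall q, tangent q -> tangent q -> R;
  rmetric_sym : forall q (X Y : tangent q), rmetric X Y = rmetric Y X;
  rmetric_linear : forall q (Y : tangent q) (a : R) (X X' : tangent q),
    rmetric (a *: X + X') Y = a * rmetric X Y + rmetric X' Y;
  rmetric_pos : forall q (X : tangent q), X != 0 -> 0 < rmetric X X;
  rmetric_smooth : forall c, atlas c -> forall u v : 'rV[R]_n,
    smooth_on (c @` dom c)
      (fun x => rmetric (tvec (cinv c x) c u) (tvec (cinv c x) c v) : R) }.

(* A C^1 curve parametrized by [0, 1] is given by a C^1 curve on an open set
   containing [0, 1]. *)
Definition C1_curve (gamma : R -> S) : Prop :=
  exists O : set R, [/\ open O, `[0, 1] `<=` O & @C1_into R O gamma].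

Definition velocity (gamma : R -> S) (t : R) : tangent (gamma t) :=
  let c := chart_at (gamma t) in tvec (gamma t) c ((c \o gamma)^`()%classic t).

Lemma velocityE (O : set R) (gamma : R -> S) (t : R) c :
  O t -> @C1_into R O gamma -> chart_around (gamma t) c ->
  velocity gamma t c = (c \o gamma)^`()%classic t.
Proof.
move=> Ot [gc gC1] tc; rewrite /velocity; have ta := chart_atP (gamma t).
move: (chart_at _) ta => a ta; rewrite tvecE//.
have dg d : chart_around (gamma t) d -> differentiable (d \o gamma) t.
  by move=> td; have [+ _] := gC1 d td.1; apply; split=> //; exact: td.2.
have [dca dE] := diff_comp_at (erefl ((a \o gamma) t)) (dg _ ta)
  (transition_differentiable ta tc).
have nE : \forall s \near t, ((c \o cinv a) \o (a \o gamma)) s = (c \o gamma) s.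
  near=> s; rewrite /= cmapK//.
  near: s; apply: gc => //; apply: open_nbhs_nbhs.
  by split; [exact: open_dom|exact: ta.2].
have [_ cE] := near_eq_differentiable nE dca.
have cdE := congr1 (fun h => h 1) (etrans cE dE).
apply: etrans (esym (etrans (derive1E' (dg c tc)) cdE)).
exact: (congr1 ('d (c \o cinv a) (a (gamma t))) (derive1E' (dg a ta))).
Unshelve. all: by end_near. Qed.

Definition curve_length (g : riemannian_metric) (gamma : R -> S) : \bar R :=
  (\int[@lebesgue_measure R]_(t in `[0%R, 1%R])
     (Num.sqrt (g (gamma t) (velocity gamma t) (velocity gamma t)))%:E)%E.

(* [piecewise_C1_path q gs q'] : the list [gs] of C^1 curves can be concatenated
   into a piecewise C^1 curve from [q] to [q']. *)
Fixpoint piecewise_C1_path q (gs : seq (R -> S)) q' : Prop :=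
  if gs is gamma :: gs' then
    [/\ C1_curve gamma, gamma 0 = q & piecewise_C1_path (gamma 1) gs' q']
  else q = q'.

(* It is +oo for points in different connected components. *)
Definition riemannian_distance (g : riemannian_metric) q q' : \bar R :=
  ereal_inf [set (\sum_(gamma <- gs) curve_length g gamma)%E |
             gs in [set gs | piecewise_C1_path q gs q']].

End Manifold.

Section Dual.
Context (R : realType) (Y : normedModType R).

Definition dual : set (Y -> R) :=
  [set f | (forall (a : R) y z, f (a *: y + z) = a * f y + f z) /\
           continuous f].

Definition dual_norm (f : Y -> R) : R :=
  sup [set `|f y| | y in [set y | `|y| <= 1]].

(* A functional on a subspace [W] is represented by its extension by 0. *)
Definition subspace_dual (W : set Y) : set (Y -> R) :=
  [set f | [/\ forall (a : R) y z, W y -> W z -> f (a *: y + z) = a * f y + f z,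
               {within W, continuous f} & f \_ W = f]].

End Dual.

(* A continuous injective linear map E -> Y^* in curried form; Y^* carries the
   dual norm. *)
Definition dual_embedding (R : realType) (E Y : normedModType R)
    (iota : E -> Y -> R) : Prop :=
  [/\ forall e, dual (iota e),
      forall (a : R) e e' y, iota (a *: e + e') y = a * iota e y + iota e' y,
      injective iota &
      forall e0, dual_norm (iota e - iota e0) @[e --> e0] --> (0 : R)].

Definition euclidean_norm (R : realType) k (x : 'rV[R]_k) : R :=
  Num.sqrt (\sum_i x ord0 i ^+ 2).

Section Probes.
Context (R : realType) (n : nat) (S : manifold R n) (p : S).
Context (Y E : normedModType R) (A : S -> Y) (iota : E -> Y -> R).

(* Restriction to L(V) with L = dA_p, extended by 0 as in [subspace_dual]. *)
Definition restriction (l : E) : Y -> R :=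
  iota l \_ (range (@mdiff R n S Y A p)).

(* The topology of 'rV[E]_N is that of the sup norm on E^N. *)
Definition Theta N (l : 'rV[E]_N) (q : S) : 'rV[R]_N :=
  \row_i iota (l ord0 i) (A q).

Definition inf_complete N (l : 'rV[E]_N) : Prop :=
  injective (@mdiff R n S _ (Theta l) p).

Definition probe_number : \bar nat :=
  match pselect (exists N, `[< exists l : 'rV[E]_N, inf_complete l >]) with
  | left exN => (ex_minn exN)%:E
  | right _ => +oo%E
  end.

End Probes.

(* Main.v *)
(* With [D := dA_p] read in a chart, [d(Theta_l)_p] is right multiplication by the
   matrix [(iota (l_i) (D e_j))_{j,i}], so a family is infinitesimally complete iff
   this matrix is row free. Hence at least [n] probes are needed, and [n] suffice:
   when [D] is injective, the surjectivity of the restriction map provides probes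
   dual to [D e_1, ..., D e_n]. Being row free is an open condition, and a dense one
   because [M0 + t M1] with [M1 B = 1] is row free unless [-t] is an eigenvalue of
   [M0 B].

   Parts (4) and (5) rest on the inverse function theorem in a chart. On a small
   chart ball, Riemannian distance and chart distance are equivalent. Segments give
   the upper bound. For the lower bound, a curve may leave the chart, so the chart
   coordinates are multiplied by a C^1 cutoff and extended by 0 to functions on all
   of [S]; their derivative along any C^1 curve is at most a constant times the
   speed of the curve, and integrating bounds their increments by the length. *)

Require Import Defs.
From HB Require Import structures.
From mathcomp Require Import all_boot all_order all_algebra.
From mathcomp Require Import ring lra.
From mathcomp Require Import all_classical all_reals all_analysis.

Import Order.TTheory GRing.Theory Num.Theory.
Import numFieldNormedType.Exports.

Local Open Scope classical_set_scope.
Local Open Scope ring_scope.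

Set Implicit Arguments.
Unset Strict Implicit.
Unset Printing Implicit Defensive.

(** * Linear maps on row vectors *)

Section RowVectors.
Context (R : realType).

Lemma coord_le_norm n (u : 'rV[R]_n) i : `|u ord0 i| <= `|u|.
Proof.
rewrite [leRHS]/Num.Def.normr/= mx_normrE.
exact: (le_bigmax _ (fun ij : 'I_1 * 'I_n => `|u ij.1 ij.2|) (ord0, i)).
Qed.

Lemma norm_row_le n (u : 'rV[R]_n) (e : R) : 0 <= e ->
  (forall i, `|u ord0 i| <= e) -> `|u| <= e.
Proof.
move=> e0 ue; rewrite /Num.Def.normr/= mx_normrE (bigmax_le _ e0)//= => -[i j] _.
by rewrite (ord1 i).
Qed.

Lemma norm_le_euclidean n (u : 'rV[R]_n) : `|u| <= euclidean_norm u.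
Proof.
apply: norm_row_le => [|i]; first exact: sqrtr_ge0.
rewrite -sqrtr_sqr ler_wsqrtr// (bigD1 i)//= lerDl.
by apply: sumr_ge0 => j _; exact: sqr_ge0.
Qed.

(** Each of the n squares is at most the square of the sup norm, and n <= (n+1)^2. The crude
    constant [n.+1] stays positive for n = 0. *)
Lemma euclidean_le_norm n (u : 'rV[R]_n) : euclidean_norm u <= n.+1%:R * `|u|.
Proof.
have u0 : 0 <= n.+1%:R * `|u| by rewrite mulr_ge0.
rewrite -(ger0_norm u0) -sqrtr_sqr ler_wsqrtr//.
apply: (@le_trans _ _ (\sum_(i < n) `|u| ^+ 2)).
  apply: ler_sum => i _; rewrite -[leLHS]real_normK ?num_real//.
  by rewrite ler_pXn2r ?nnegrE// coord_le_norm.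
rewrite sumr_const card_ord -[leLHS]mulr_natr exprMn mulrC ler_wpM2r ?sqr_ge0//.
by rewrite -natrX ler_nat expnS expn1 (leq_trans (leqnSn n))// leq_pmulr.
Qed.

Lemma linear_row (W : lmodType R) n (f : {linear 'rV[R]_n -> W}) u :
  f u = \sum_i u ord0 i *: f (delta_mx ord0 i).
Proof.
rewrite {1}[u]row_sum_delta linear_sum.
by apply: eq_bigr => i _; rewrite linearZ.
Qed.

(** The n coordinates contribute at most [e / n.+1 * |u|] each. This turns estimates on basis
    vectors into operator norm estimates. *)
Lemma linear_row_le (W : normedModType R) n (f : {linear 'rV[R]_n -> W}) (e : R) :
  0 <= e -> (forall i, `|f (delta_mx ord0 i)| <= e / n.+1%:R) ->
  forall u, `|f u| <= e * `|u|.
Proof.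
move=> e0 fe u; rewrite linear_row (le_trans (ler_norm_sum _ _ _))//.
apply: (@le_trans _ _ (\sum_(i < n) (e / n.+1%:R * `|u|))).
  apply: ler_sum => i _; rewrite normrZ mulrC ler_pM//.
  exact: coord_le_norm.
rewrite sumr_const card_ord -[leLHS]mulr_natr -!mulrA ler_wpM2l// mulrCA ler_piMr//.
by rewrite mulrC ler_pdivrMr// mul1r ler_nat.
Qed.

Lemma linear_row_bounded (W : normedModType R) n (f : {linear 'rV[R]_n -> W}) :
  exists2 e : R, 0 < e & forall u, `|f u| <= e * `|u|.
Proof.
pose s : R := \sum_i `|f (delta_mx ord0 i)|.
have s0 : 0 <= s by exact: sumr_ge0.
exists (n.+1%:R * (s + 1)); first by rewrite mulr_gt0// ltr_wpDl.
apply: linear_row_le; first by rewrite mulr_ge0// addr_ge0.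
move=> i; rewrite mulrAC divff// mul1r.
apply: (@le_trans _ _ s); last by rewrite lerDl.
by rewrite /s (bigD1 i)//= lerDl sumr_ge0.
Qed.

Lemma linear_row_continuous (W : normedModType R) n (f : {linear 'rV[R]_n -> W}) :
  continuous f.
Proof.
apply: bounded_linear_continuous; apply/linear_boundedP.
have [e e0 fe] := linear_row_bounded f.
by near=> r => u; apply: (le_trans (fe u)); exact: ler_wpM2r.
Unshelve. all: by end_near. Qed.

Lemma row_cvg (T : Type) (F : set_system T) {FF : Filter F} n
    (f : T -> 'rV[R]_n) (u : 'rV[R]_n) :
  (forall i, (fun t => f t ord0 i) @ F --> u ord0 i) -> f @ F --> u.
Proof.
move=> fu; apply/cvgrPdist_le => e e0; near=> t.
apply: norm_row_le => [|i]; first exact: ltW.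
rewrite !mxE; move: i; near: t; apply: filter_forall => i.
by have /cvgrPdist_le := fu i; exact.
Unshelve. all: by end_near. Qed.

(** By compactness, [N] attains a minimum on the unit sphere, and homogeneity carries it to all
    vectors. The form covers both [|f u|] for injective linear [f] and Riemannian norms in a
    chart. *)
Lemma homogeneous_lower_bound n (N : 'rV[R]_n -> R) :
  continuous N -> (forall a u, N (a *: u) = `|a| * N u) ->
  (forall u, u != 0 -> 0 < N u) ->
  exists2 c : R, 0 < c & forall u, c * `|u| <= N u.
Proof.
move=> Nc NZ Npos.
have NS u : u != 0 -> N u = `|u| * N (`|u|^-1 *: u).
  move=> u0; rewrite NZ mulrA normfV normr_id mulfV ?mul1r//.
  by rewrite normr_eq0.
have N0 : N 0 = 0 by rewrite -[X in N X](scale0r 0) NZ normr0 mul0r.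
pose B := [set u : 'rV[R]_n | `|u| = 1].
(* The sphere is empty when n = 0; then every vector is 0 and any constant works. *)
have [B0|] := pselect (B !=set0); last first.
  move=> B0; exists 1; first by [].
  move=> u; have [->|u0] := eqVneq u 0; first by rewrite normr0 N0 mulr0.
  exfalso; apply: B0; exists (`|u|^-1 *: u).
  by rewrite /B /= normrZ normfV normr_id mulVf// normr_eq0.
have cB : compact B.
  apply: bounded_closed_compact.
    by exists 1; split => // x x1 u /= ->; exact: ltW.
  have -> : B = (fun u : 'rV[R]_n => `|u|) @^-1` [set 1] by [].
  apply: closed_comp => [u _|]; first exact: norm_continuous.
  exact: closed_eq.
have [v + vmin] := EVT_min_rV B0 cB (continuous_subspaceT Nc).
rewrite inE => v1.
have vn0 : v != 0 by rewrite -normr_eq0 v1 oner_eq0.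
exists (N v); first exact: Npos.
move=> u; have [->|u0] := eqVneq u 0; first by rewrite normr0 N0 mulr0.
rewrite (NS u u0) mulrC ler_wpM2l// vmin// inE /B /=.
by rewrite normrZ normfV normr_id mulVf// normr_eq0.
Qed.

Lemma injective_lower_bound n (W : normedModType R) (f : {linear 'rV[R]_n -> W}) :
  injective f -> exists2 c : R, 0 < c & forall u, c * `|u| <= `|f u|.
Proof.
move=> fI; apply: (homogeneous_lower_bound (N := fun u => `|f u|)).
- move=> u; apply: (@continuous_comp _ _ _ f (fun w => `|w|)).
    exact: linear_row_continuous.
  exact: norm_continuous.
- by move=> a u; rewrite linearZ normrZ.
- move=> u; rewrite normr_gt0; apply: contra_neq => fu0.
  by apply: fI; rewrite fu0 linear0.
Qed.

(** A vector w with [g w = 0] would satisfy [c * |w| <= |f w| <= c / 2 * |w|], hence w = 0. *)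
Lemma near_injective n (W : normedModType R) (f g : {linear 'rV[R]_n -> W}) (c : R) :
  0 < c -> (forall u, c * `|u| <= `|f u|) ->
  (forall u, `|g u - f u| <= c / 2 * `|u|) -> injective g.
Proof.
move=> c0 cf gf u v guv; apply/eqP; rewrite -subr_eq0 -normr_le0.
have := gf (u - v); have := cf (u - v).
rewrite [g _]linearB /= guv subrr sub0r normrN => h1 h2.
by rewrite -(ler_pM2l c0) mulr0; lra.
Qed.

End RowVectors.

(** * C^1 maps on R^n and the inverse function theorem *)

Section DifferentialCalculus.
Context (R : realType).
Implicit Types (V W : normedModType R).

Lemma continuous_estimate (T : topologicalType) W (f : T -> W) x :
  {for x, continuous f} <->
  forall e : R, 0 < e -> \forall y \near x, `|f x - f y| <= e.
Proof. exact: cvgrPdist_le. Qed.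

(** Pointwise continuity on the finitely many basis vectors already gives continuity in operator
    norm. *)
Lemma linear_family_uniform W n (T : topologicalType)
    (D : T -> {linear 'rV[R]_n -> W}) y (e : R) :
  (forall u (e : R), 0 < e -> \forall z \near y, `|D z u - D y u| <= e) -> 0 < e ->
  \forall z \near y, forall u, `|D z u - D y u| <= e * `|u|.
Proof.
move=> Dc e0; near=> z => u.
apply: (linear_row_le (f := D z \- D y)); first exact: ltW.
move=> i; move: i; near: z; apply: filter_forall => i; apply: Dc.
by rewrite divr_gt0.
Unshelve. all: by end_near. Qed.

(** With [u = w y - w z], near [y] one has [c / 2 * |u| <= |D z u|], and
    [D z u = D z (w y) - D y (w y)] tends to 0. This will give continuity of the derivative of an
    inverse map. *)
Lemma linear_family_inverse W n (T : topologicalType)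
    (D : T -> {linear 'rV[R]_n -> W}) (w : T -> 'rV[R]_n) v y :
  (forall u (e : R), 0 < e -> \forall z \near y, `|D z u - D y u| <= e) ->
  injective (D y) -> (\forall z \near y, D z (w z) = v) ->
  {for y, continuous w}.
Proof.
move=> Dc DI Dw; have Dwy := nbhs_singleton Dw.
have [c c0 cle] := injective_lower_bound DI.
have c20 : 0 < c / 2 by rewrite divr_gt0.
have near1 := linear_family_uniform Dc c20.
apply/continuous_estimate => e e0.
have near2 := Dc (w y) _ (mulr_gt0 c20 e0).
near=> z; rewrite -(ler_pM2l c20); set u := w y - w z.
have h1 : `|D z u| <= c / 2 * e.
  rewrite linearB /=.
  have -> : D z (w z) = v by near: z.
  by rewrite -Dwy; near: z.
apply: le_trans h1.
have h2 : `|D z u - D y u| <= c / 2 * `|u|.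
  by move: (u); near: z.
have := ler_distD (D z u) (D y u) 0; have h3 := cle u.
rewrite !subr0 distrC => h4.
by lra.
Unshelve. all: by end_near. Qed.

(** The base point moves along a continuous [g], so that the differential of a map can also be
    followed along its inverse. *)
Lemma C1_diff_cvg (T : topologicalType) V W (A : set V) (f : V -> W) (g : T -> V)
    y u (e : R) : open A -> A (g y) -> Ck 1 A f -> {for y, continuous g} -> 0 < e ->
  \forall z \near y, `|'d f (g z) u - 'd f (g y) u| <= e.
Proof.
move=> oA Aa [df cf] gc e0.
have cfg : {for y, continuous ('D_u f \o g)}.
  by apply: continuous_comp => //; exact: cf.
near=> z.
have Ax : A (g z).
  by near: z; apply: (gc A); exact: open_nbhs_nbhs.
have -> : 'd f (g z) u - 'd f (g y) u = 'D_u f (g z) - 'D_u f (g y).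
  by congr (_ - _); symmetry; apply: deriveE; exact: df.
by rewrite distrC; near: z; exact: ((continuous_estimate _ _).1 cfg).
Unshelve. all: by end_near. Qed.

Lemma C1_diff_near W n (A : set 'rV[R]_n) (f : 'rV[R]_n -> W) a (e : R) :
  open A -> A a -> Ck 1 A f -> 0 < e ->
  \forall x \near a, forall u, `|'d f x u - 'd f a u| <= e * `|u|.
Proof.
move=> oA Aa fC1; apply: (linear_family_uniform (D := fun x => 'd f x)) => u e'.
exact: (C1_diff_cvg (g := id) u oA Aa fC1).
Qed.

Lemma is_derive_line V W (f : V -> W) (y u : V) (t : R) :
  differentiable f (y + t *: u) ->
  is_derive t 1 (fun s : R => f (y + s *: u)) ('d f (y + t *: u) u).
Proof.
move=> df.
have dg : is_diff t (fun s : R => y + s *: u) (fun s : R => s *: u).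
  by apply: is_diff_eq; rewrite add0r.
have [dfg dE] := diff_comp_at (f := fun s : R => y + s *: u) (erefl (y + t *: u))
  (@ex_diff _ _ _ _ _ _ _ dg) df.
apply: DeriveDef; first exact: diff_derivable.
rewrite deriveE// dE /= (congr1 (fun h => h 1) (@diff_val _ _ _ _ _ _ _ dg)).
by rewrite scale1r.
Qed.

Lemma is_derive_coord V k (f : V -> 'rV[R]_k) df x v i :
  is_derive x v f df -> is_derive x v (fun y => f y ord0 i) (df ord0 i).
Proof.
move=> [fx <-]; apply: DeriveDef; first by move/derivable_mxP : fx.
by rewrite derive_mx// mxE.
Qed.

Lemma ball_segment V (a x y : V) (r t : R) : ball a r x -> ball a r y ->
  0 <= t -> t <= 1 -> ball a r (y + t *: (x - y)).
Proof.
rewrite -ball_normE /= => ax ay t0 t1.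
have -> : a - (y + t *: (x - y)) = (1 - t) *: (a - y) + t *: (a - x).
  have -> : a - x = (a - y) - (x - y) by rewrite opprB addrA subrK.
  by rewrite scalerBl scale1r [t *: (_ - (x - y))]scalerBr addrA subrK opprD addrA.
apply: le_lt_trans (ler_normD _ _) _; rewrite !normrZ ger0_norm ?subr_ge0//.
rewrite (ger0_norm t0).
(* Strictness comes from the term with factor [t], so [t = 0] is treated apart. *)
have [->|tn0] := eqVneq t 0; first by rewrite subr0 mul1r mul0r addr0.
have -> : r = (1 - t) * r + t * r by rewrite -mulrDl subrK mul1r.
rewrite ler_ltD//; first by rewrite ler_wpM2l ?subr_ge0// ltW.
by rewrite ltr_pM2l// lt_neqAle eq_sym tn0.
Qed.

(** The scalar mean value theorem is applied to each coordinate on the segment from [y] to [x]. The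
    intermediate point depends on the coordinate, which is harmless for the sup norm. *)
Lemma row_mean_value n k (f : 'rV[R]_n -> 'rV[R]_k)
    (L : {linear 'rV[R]_n -> 'rV[R]_k}) a (r e : R) : 0 <= e ->
  (forall x, ball a r x ->
     differentiable f x /\ forall u, `|'d f x u - L u| <= e * `|u|) ->
  forall x y, ball a r x -> ball a r y ->
    `|f x - f y - L (x - y)| <= e * `|x - y|.
Proof.
move=> e0 fL x y ax ay; apply: norm_row_le => [|i]; first by rewrite mulr_ge0.
pose h (s : R) : R := f (y + s *: (x - y)) ord0 i - s * L (x - y) ord0 i.
pose dh (s : R) : R :=
  'd f (y + s *: (x - y)) (x - y) ord0 i - L (x - y) ord0 i.
have hd (s : R) : s \in `[0, 1] -> is_derive s 1 h (dh s).
  rewrite in_itv /= => /andP[s0 s1].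
  have [dfs _] := fL _ (ball_segment ax ay s0 s1).
  have d1 := is_derive_coord i (is_derive_line dfs).
  apply: is_derive_eq; congr (_ - _).
  by rewrite /= scaler0 add0r [LHS]mulr1.
have [|c cI] := @MVT_segment _ h dh 0 1 ler01 (fun s sI => hd s (subset_itv_oo_cc sI)).
  apply: derivable_within_continuous => s sI.
  by have [] := hd s sI.
rewrite subr0 mulr1 /h scale1r scale0r addr0 mul1r mul0r subr0 subrKC => hE.
have := cI; rewrite in_itv /= => /andP[c0 c1].
have [_ /(_ (x - y))] := fL _ (ball_segment ax ay c0 c1).
apply: le_trans.
have -> : (f x - f y - L (x - y)) ord0 i = dh c by rewrite -hE !mxE addrAC.
apply: le_trans (coord_le_norm _ i).
by rewrite !mxE.
Qed.

Lemma injective_linear_inverse n (f : {linear 'rV[R]_n -> 'rV[R]_n}) :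
  injective f -> exists2 g : {linear 'rV[R]_n -> 'rV[R]_n},
    cancel f g & cancel g f.
Proof.
move=> fI; pose M := lin1_mx f.
have fM u : f u = u *m M by rewrite mul_rV_lin1.
have uM : M \in unitmx.
  rewrite -row_free_unit -kermx_eq0; apply/eqP/row_matrixP => i.
  apply: fI; rewrite row0 linear0 fM -row_mul mulmx_ker.
  by rewrite row0.
exists (mulmxr (invmx M)) => u; first by rewrite fM /= mulmxK.
by rewrite fM /= mulmxKV.
Qed.

Lemma diff_estimate V W (f : V -> W) (a : V) (e : R) : differentiable f a -> 0 < e ->
  \forall x \near a, `|f x - f a - 'd f a (x - a)| <= e * `|x - a|.
Proof.
move=> df e0; have /eqaddoP/(_ e e0) dfE := diff_locally df.
rewrite (near_shift 0) subr0; apply: filterS dfE => x /=.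
by rewrite !fctE /= addrK opprD addrA.
Qed.

Lemma differentiable_estimate V W (f : V -> W) (a : V) (L : {linear V -> W}) :
  continuous L ->
  (forall e : R, 0 < e ->
    \forall x \near a, `|f x - f a - L (x - a)| <= e * `|x - a|) ->
  differentiable f a /\ 'd f a = L :> (V -> W).
Proof.
move=> Lc fL.
have fE : f \o shift a = cst (f a) + L +o_ 0 id.
  apply/eqaddoP => e /fL; rewrite (near_shift 0) subr0; apply: filterS => y /=.
  by rewrite !fctE /= addrK opprD addrA.
have dE := diff_unique Lc fE.
by split=> //; apply/diff_locallyP; rewrite dE.
Qed.

(** With [h = g y - g b] and [k = y - b], the remainder of [g] is [L] applied to that of [f], up to
    sign; a bound [|h| <= 2 * K * |k|] converts errors relative to [h] into errors relative to
    [k]. *)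
Lemma differentiable_inverse n (f g : 'rV[R]_n -> 'rV[R]_n) b
    (L : {linear 'rV[R]_n -> 'rV[R]_n}) :
  differentiable f (g b) -> cancel ('d f (g b)) L -> {for b, continuous g} ->
  (\forall y \near b, f (g y) = y) ->
  differentiable g b /\ 'd g b = L :> ('rV[R]_n -> 'rV[R]_n).
Proof.
move=> df fK gc fgK.
have [K K0 LK] := linear_row_bounded L.
apply: differentiable_estimate => [|e e0]; first exact: linear_row_continuous.
(* The first bound absorbs the error term and yields [|h| <= 2 * K * |k|]; the second makes the
   final error [e * |k|]. *)
pose e' := Order.min (2 * K)^-1 (e / (2 * K * K)).
have e'0 : 0 < e' by rewrite lt_min invr_gt0 divr_gt0 ?mulr_gt0.
have dfE := gc _ (diff_estimate df e'0).
near=> y.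
have : `|f (g y) - f (g b) - 'd f (g b) (g y - g b)| <= e' * `|g y - g b|.
  by near: y; exact: dfE.
have -> : f (g y) = y by near: y.
rewrite (nbhs_singleton fgK); move: (g y - g b) (y - b) => h k hk.
have hK : `|h| <= 2 * K * `|k|.
  have h1 : `|h| <= K * (`|k| + e' * `|h|).
    rewrite -{1}(fK h) (le_trans (LK _))// ler_wpM2l ?(ltW K0)//.
    by rewrite -lerBlDl (le_trans _ hk)// distrC; exact: lerB_dist.
  have : e' * `|h| <= (2 * K)^-1 * `|h| by rewrite ler_wpM2r// ge_min lexx.
  move=> /(ler_wpM2l (ltW K0)).
  have -> : K * ((2 * K)^-1 * `|h|) = `|h| / 2 by field; rewrite gt_eqF.
  by lra.
have -> : h - L k = L ('d f (g b) h - k) by rewrite linearB /= fK.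
rewrite distrC in hk.
apply: (le_trans (LK _)).
have h1 : e' * `|h| <= e / (2 * K * K) * (2 * K * `|k|).
  by apply: ler_pM => //; [exact: ltW|rewrite ge_min lexx orbT].
apply: le_trans (ler_wpM2l (ltW K0) (le_trans hk h1)) _.
by rewrite le_eqVlt; apply/orP; left; apply/eqP; field; rewrite gt_eqF.
Unshelve. all: by end_near. Qed.

(** The derivative of [g] at z in direction v is the solution w of ['d f (g z) w = v], so its
    continuity is an instance of [linear_family_inverse]. *)
Lemma C1_inverse n (A B : set 'rV[R]_n) (f g : 'rV[R]_n -> 'rV[R]_n) :
  open A -> open B -> Ck 1 A f ->
  (forall x, A x -> injective ('d f x)) ->
  (forall y, B y -> [/\ A (g y), f (g y) = y & {for y, continuous g}]) ->
  Ck 1 B g.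
Proof.
move=> oA oB fC1 fI gB.
have dg y : B y -> differentiable g y /\
    forall u, 'd f (g y) ('d g y u) = u.
  move=> By; have [Ag _ gc] := gB y By.
  have [L fK Kf] := injective_linear_inverse (fI _ Ag).
  have [|dgy dgE] := differentiable_inverse (fC1.1 _ Ag) fK gc.
    by apply: filterS (open_nbhs_nbhs (conj oB By)) => z /gB[].
  split=> [|u]; first exact: dgy.
  exact: etrans (congr1 (fun h => 'd f (g y) (h u)) dgE) (Kf u).
split=> [y By|v y By]; first exact: (dg y By).1.
have [Ag _ gc] := gB y By.
have near_d z : B z -> 'D_v g z = 'd g z v by move=> /dg[dgz _]; exact: deriveE.
apply: (linear_family_inverse (D := fun z => 'd f (g z)) (v := v)).
- by move=> u e e0; apply: (C1_diff_cvg (f := f) (g := g) u oA Ag fC1 gc e0).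
- exact: fI.
- near=> z; have Bz : B z by near: z; exact: open_nbhs_nbhs.
  by rewrite (near_d z Bz); exact: (dg z Bz).2.
Unshelve. all: by end_near. Qed.

End DifferentialCalculus.

Lemma continuous_dist (R : realType) (T : topologicalType) (W : normedModType R)
    (f : T -> W) (w : W) x :
  {for x, continuous f} -> {for x, continuous (fun y => `|w - f y|)}.
Proof. by move=> fc; apply: cvg_norm; apply: cvgB => //; exact: cvg_cst. Qed.

Lemma compact_rV_ball (R : realType) n (a : 'rV[R]_n) (s : R) :
  compact [set x | `|a - x| <= s].
Proof.
apply: bounded_closed_compact; last exact: closed_closed_ball_.
exists (`|a| + s); split; first by rewrite num_real.
move=> x xs u au; apply: ltW; apply: le_lt_trans xs.
by rewrite -lerBlDl (le_trans _ au)// distrC lerB_dist.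
Qed.

(** * Maps close to an injective linear map *)

Section NearLinear.
Context (R : realType) (n : nat).
Implicit Types (f : 'rV[R]_n -> 'rV[R]_n) (L : {linear 'rV[R]_n -> 'rV[R]_n}).

Lemma near_linear_lower f L (B : set 'rV[R]_n) (c e : R) :
  (forall u, c * `|u| <= `|L u|) ->
  (forall x y, B x -> B y -> `|f x - f y - L (x - y)| <= e * `|x - y|) ->
  forall x y, B x -> B y -> (c - e) * `|x - y| <= `|f x - f y|.
Proof.
move=> cL fL x y Bx By; have h1 := fL x y Bx By; have h2 := cL (x - y).
have := ler_distD (f x - f y) (L (x - y)) 0.
by rewrite !subr0 [`|L _ - _|]distrC => h3; lra.
Qed.

Lemma near_linear_upper f L (B : set 'rV[R]_n) (c e : R) :
  (forall u, `|L u| <= c * `|u|) ->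
  (forall x y, B x -> B y -> `|f x - f y - L (x - y)| <= e * `|x - y|) ->
  forall x y, B x -> B y -> `|f x - f y| <= (c + e) * `|x - y|.
Proof.
move=> cL fL x y Bx By; have h1 := fL x y Bx By; have h2 := cL (x - y).
have := ler_distD (L (x - y)) (f x - f y) 0.
by rewrite !subr0 => h3; lra.
Qed.

(* Every [y] close to [f x1] is attained where [x |-> |y - f x|] is minimal on a
   small closed ball: at a minimizer [x] with [w := y - f x != 0], moving [x] in
   the direction [L^-1 w] would decrease the distance. *)
Lemma near_linear_open_image f L a (r c e : R) :
  0 < c -> 0 <= e -> e <= c / 2 -> (forall u, c * `|u| <= `|L u|) ->
  (forall x y, ball a r x -> ball a r y ->
    `|f x - f y - L (x - y)| <= e * `|x - y|) ->
  open (f @` ball a r).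
Proof.
move=> c0 e0 ec cL fL.
have LI : injective L.
  move=> x y Lxy; have := cL (x - y); rewrite linearB /= Lxy subrr normr0.
  by rewrite pmulr_rle0// normr_le0 subr_eq0 => /eqP.
have [Li LK KL] := injective_linear_inverse LI.
have Lic v : c * `|Li v| <= `|v| by rewrite (le_trans (cL _))// KL.
have flow := near_linear_lower cL fL.
have [k k0 kL] := linear_row_bounded L.
have fup := near_linear_upper kL fL.
have fc x : ball a r x -> {for x, continuous f}.
  move=> ax; apply/continuous_estimate => d d0; near=> z.
  have az : ball a r z.
    by near: z; apply: open_nbhs_nbhs; split=> //; exact: ball_open.
  apply: le_trans (fup _ _ ax az) _.
  rewrite -ler_pdivlMl ?ltr_wpDr//; near: z.
  apply: cvgr_dist_le; first exact: cvg_id.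
  by rewrite mulrC divr_gt0 ?ltr_wpDr.
rewrite openE => _ [x1 ax1 <-].
have : nbhs x1 (ball a r) by apply: open_nbhs_nbhs; split=> //; exact: ball_open.
move=> /nbhs_ballP[s2 s20 s2r]; rewrite /= in s20.
pose s := s2 / 2; have s0 : 0 < s by rewrite divr_gt0.
pose D := [set x : 'rV[R]_n | `|x1 - x| <= s].
have Dball : D `<=` ball a r.
  move=> x Dx; apply: s2r; rewrite -ball_normE /=; apply: le_lt_trans Dx _.
  by rewrite /s ltr_pdivrMr// mulr_natr mulr2n ltrDl.
have cD : compact D by exact: compact_rV_ball.
have D0 : D !=set0 by exists x1; rewrite /D /= subrr normr0 ltW.
apply/nbhs_ballP; exists (c / 4 * s); first by rewrite /= mulr_gt0// divr_gt0.
move=> y yx1; rewrite -ball_normE /= in yx1.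
pose phi (x : 'rV[R]_n) : R := `|y - f x|.
have phic : {within D, continuous phi}.
  apply: continuous_in_subspaceT => x; rewrite inE => Dx.
  by apply: continuous_dist; exact: fc (Dball _ Dx).
have [x] := EVT_min_rV D0 cD phic; rewrite inE => Dx xmin.
exists x; first exact: Dball.
apply/eqP; rewrite eq_sym -subr_eq0 -normr_le0 leNgt; apply/negP => w0.
set w := y - f x in w0.
have wx1 : `|w| <= `|y - f x1|.
  by apply: (xmin x1); rewrite inE /D /= subrr normr0 ltW.
(* The minimizer is interior: [c / 2 * |x1 - x| <= |f x1 - f x| <= 2 * |y - f x1| < c / 2 * s]. *)
have xin : `|x1 - x| < s.
  have := flow _ _ ax1 (Dball _ Dx).
  have := ler_distD y (f x1) (f x); rewrite -/w [`|y - f x1|]distrC in wx1 * => h1 h2.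
  rewrite -(ltr_pM2l c0).
  have : c / 2 * `|x1 - x| <= (c - e) * `|x1 - x| by rewrite ler_wpM2r//; lra.
  by lra.
pose d := s - `|x1 - x|; have d0 : 0 < d by rewrite subr_gt0.
have Liw0 : 0 <= `|Li w| by [].
(* This step length satisfies [0 < t <= 1] and [t * |Li w| <= d], which keeps [x'] in [D]. *)
pose t := d / (d + `|Li w|).
have dL0 : 0 < d + `|Li w| by rewrite ltr_pwDl.
have t0 : 0 < t by rewrite divr_gt0.
have t1 : t <= 1 by rewrite ler_pdivrMr// mul1r lerDl.
have td : t * `|Li w| <= d.
  rewrite mulrAC ler_pdivrMr// ler_wpM2l//; first exact: ltW.
  by rewrite lerDr ltW.
pose x' := x + t *: Li w.
have Dx' : D x'.
  rewrite /D /= /x' opprD addrA (le_trans (ler_normB _ _))//.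
  by rewrite normrZ gtr0_norm// -lerBrDl.
have := xmin x'; rewrite inE => /(_ Dx'); rewrite leNgt => /negP; apply.
have := fL _ _ (Dball _ Dx') (Dball _ Dx).
rewrite /phi -/w.
have -> : x' - x = t *: Li w by rewrite /x' addrAC subrr add0r.
rewrite linearZ /= KL normrZ gtr0_norm// => h1.
have h2 : `|f x' - f x - t *: w| <= t / 2 * `|w|.
  apply: (le_trans h1); have := Lic w.
  have : e * `|Li w| <= c / 2 * `|Li w| by rewrite ler_wpM2r.
  move=> h2 h3; rewrite mulrCA -mulrA ler_wpM2l//; first exact: ltW.
  by lra.
(* The new distance is at most [(1 - t) * |w| + t / 2 * |w|], strictly less than [|w|]. *)
have -> : y - f x' = (1 - t) *: w - (f x' - f x - t *: w).
  by rewrite scalerBl scale1r opprB addrA subrK opprB addrA /w subrK.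
apply: le_lt_trans (ler_normB _ _) _.
rewrite normrZ ger0_norm ?subr_ge0//.
have : 0 < t * `|w| by rewrite mulr_gt0.
by lra.
Unshelve. all: by end_near. Qed.

End NearLinear.

(** * Functionals, matrix entries and row-free perturbations *)

Section GeneralFacts.
Context (R : realType).

Lemma near_eq_continuous (T U : topologicalType) (f g : T -> U) x :
  (\forall y \near x, f y = g y) -> {for x, continuous f} -> {for x, continuous g}.
Proof.
move=> fg; rewrite /prop_for /continuous_at (nbhs_singleton fg).
by apply: cvg_trans; apply: near_eq_cvg.
Qed.

Lemma C1_linear_comp (V W W' : normedModType R) (L : {linear W -> W'}) (B : set V)
    (f : V -> W) : continuous L -> open B -> Ck 1 B f -> Ck 1 B (L \o f).
Proof.
move=> Lc oB [df cf].
have dLf x : B x -> differentiable (L \o f) x /\ 'd (L \o f) x = L \o 'd f x :> (V -> W').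
  move=> Bx; have [d1 d2] := diff_comp_at (erefl (f x)) (df x Bx)
    (linear_differentiable (f x) Lc).
  by split=> //; rewrite d2 diff_lin.
split=> [x Bx|v x Bx]; first exact: (dLf x Bx).1.
apply: (@near_eq_continuous _ _ (L \o 'D_v f)); last first.
  by apply: continuous_comp; [exact: cf|exact: Lc].
near=> y; have By : B y by near: y; exact: open_nbhs_nbhs.
have [d1 d2] := dLf y By.
by rewrite (deriveE v d1) d2 /= (deriveE v (df y By)).
Unshelve. all: by end_near. Qed.

Lemma entry_continuous (T : topologicalType) m n i j :
  continuous (fun M : 'M[T]_(m, n) => M i j).
Proof.
(* This product neighbourhood constrains only the entry at [i], [j]. *)
move=> M B MB; exists (fun i' j' => [set x | i' = i -> j' = j -> B x]).
  move=> i' j'.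
  have [->|ni] := eqVneq i' i; last first.
    by apply: filterS filterT => x _ ii; rewrite ii eqxx in ni.
  have [->|nj] := eqVneq j' j; last first.
    by apply: filterS filterT => x _ _ jj; rewrite jj eqxx in nj.
  by apply: filterS MB => x Bx _ _.
by move=> N; exact.
Qed.

Lemma dual_norm_le (Y : normedModType R) (f : Y -> R) y :
  dual f -> `|f y| <= dual_norm f * `|y|.
Proof.
move=> [flin fc].
pose F : {linear Y -> R^o} := HB.pack f (GRing.isLinear.Build R Y R^o *:%R f flin).
have /linear_boundedP : bounded_near F (nbhs (0 : Y)).
  by apply: continuous_linear_bounded; exact: fc.
move=> /pinfty_ex_gt0[K K0 fK].
(* Boundedness ensures that [sup] is a genuine supremum and not a default value. *)
have fub : has_ubound [set `|f y| | y in [set y | `|y| <= 1]].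
  exists K => _ [z z1 <-]; apply: le_trans (fK z) _.
  by rewrite ler_piMr// ltW.
have [->|y0] := eqVneq y 0.
  by rewrite -[f 0]/(F 0) linear0 !normr0 mulr0.
have -> : f y = `|y| * f (`|y|^-1 *: y).
  by rewrite -[f _]/(F _) -[f _]/(F _) linearZ /= mulrA mulfV ?mul1r// normr_eq0.
rewrite normrM normr_id mulrC ler_wpM2r//; apply: ub_le_sup => //.
exists (`|y|^-1 *: y) => //=.
by rewrite normrZ normfV normr_id mulVf// normr_eq0.
Qed.

Lemma row_free_injective m n (M : 'M[R]_(m, n)) :
  row_free M <-> injective (fun u : 'rV[R]_m => u *m M).
Proof.
split=> [/row_free_inj|MI]; first exact.
rewrite -kermx_eq0; apply/eqP/row_matrixP => i.
by apply: MI; rewrite -row_mul mulmx_ker !row0 mul0mx.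
Qed.

(** The distinct points [d / k.+2] lie strictly between 0 and [d]; were they all roots, the first
    [size q] of them would exceed the degree. *)
Lemma exists_small_nonroot (q : {poly R}) (d : R) : q != 0 -> 0 < d ->
  exists2 t, 0 < t < d & ~~ root q t.
Proof.
move=> q0 d0; apply: contrapT => /forall2NP allroot.
pose f k : R := d / k.+2%:R.
have fd k : 0 < f k < d.
  by rewrite divr_gt0//= ltr_pdivrMr// ltr_pMr// ltr1n.
have : (size (map f (iota 0 (size q))) < size q)%N.
  apply: max_poly_roots => //.
    apply/allP => _ /mapP[k _ ->].
    by have [|/negP] := allroot (f k); rewrite ?fd// negbK.
  rewrite map_inj_uniq ?iota_uniq// => i j /(mulfI (lt0r_neq0 d0))/invr_inj.
  by move=> /eqP; rewrite eqr_nat => /eqP[].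
by rewrite size_map size_iota ltnn.
Qed.

Lemma perturbation_row_free m n (M0 M1 : 'M[R]_(m, n)) (d : R) :
  row_free M1 -> 0 < d -> exists2 t, 0 < t < d & row_free (M0 + t *: M1).
Proof.
move=> /row_freeP[B M1B] d0.
(* The sign makes the non-roots [t] themselves the parameters for which [M0 *m B + t] is invertible;
   full rank of this product passes to its left factor. *)
have q0 : char_poly (- (M0 *m B)) != 0 by exact: monic_neq0 (char_poly_monic _).
have [t td] := exists_small_nonroot q0 d0.
rewrite -eigenvalue_root_char /eigenvalue negbK /eigenspace kermx_eq0 => MB.
exists t => //; rewrite /row_free eqn_leq rank_leq_row /=.
have : row_free ((M0 + t *: M1) *m B).
  have -> : (M0 + t *: M1) *m B = - (- (M0 *m B) - t%:M).
    by rewrite mulmxDl -scalemxAl M1B scalemx1 opprD !opprK.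
  by rewrite /row_free mxrank_opp.
by move=> /eqP rE; rewrite -{1}rE mxrankM_maxl.
Qed.

End GeneralFacts.

(** * Probe matrices *)

Section ProbeMatrix.
Context (R : realType) (n : nat) (S : manifold R n) (p : S) (U : set S).
Context (Y E : normedModType R) (A : S -> Y) (iota : E -> Y -> R).
Hypotheses (oU : open U) (Up : U p) (AC1 : C1_on U A) (iotaP : dual_embedding iota).

Let c := chart_at p.
Let cp : chart_around p c := chart_atP p.
Let D : {linear 'rV[R]_n -> Y} := 'd (A \o cinv c) (c p).

Lemma chart_image_open (d : chart R n S) (O : set S) :
  open O -> open (d @` (O `&` dom d)).
Proof.
move=> oO; rewrite openE => _ [q [Oq qd] <-].
have oOd : open (O `&` dom d) by apply: openI => //; exact: open_dom.
by apply: filterS (chart_near qd oOd (conj Oq qd)) => y [yE Oy]; exists (cinv d y).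
Qed.

Lemma C1_on_linear_comp (W W' : normedModType R) (L : {linear W -> W'}) (O : set S)
    (f : S -> W) : continuous L -> open O -> C1_on O f -> C1_on O (L \o f).
Proof.
move=> Lc oO fC1 d ad; apply: (C1_linear_comp (f := f \o cinv d)) => //.
  exact: chart_image_open.
exact: fC1.
Qed.

Lemma embedding_linear e : linear (iota e : Y -> R^o).
Proof. by have [/(_ e)[el _] _ _ _] := iotaP; move=> a x y; exact: el. Qed.

Lemma embedding_lin_l y : linear (iota ^~ y : E -> R^o).
Proof. by have [_ il _ _] := iotaP; move=> a e e'; exact: il. Qed.

Lemma embedding_continuous e : continuous (iota e).
Proof. by have [/(_ e)[]] := iotaP. Qed.

(** Evaluation at [y] is controlled by the dual norm times [|y|]. Through it the probe matrix
    depends continuously on the family. *)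
Lemma embedding_continuous_l y : continuous (iota ^~ y).
Proof.
move=> e; have [id il _ ic] := iotaP.
have dd e' : dual (iota e' - iota e).
  split=> [a x z|].
    rewrite !fctE !embedding_linear; rewrite mulrBr -!/(_ *: _).
    by rewrite opprD addrACA.
  by move=> z; apply: cvgB; apply: embedding_continuous.
apply/cvgrPdist_le => r r0; near=> e'.
rewrite distrC (le_trans (dual_norm_le y (dd e')))//.
(* Dividing by [|y| + 1] covers [y = 0]. *)
apply: (@le_trans _ _ (r / (`|y| + 1) * `|y|)).
  rewrite ler_wpM2r//; near: e'.
  have r1 : 0 < r / (`|y| + 1) by rewrite divr_gt0// ltr_wpDl.
  have /cvgrPdist_le/(_ _ r1) := ic e.
  by apply: filterS => e'; rewrite sub0r normrN; exact/le_trans/ler_norm.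
by rewrite mulrAC ler_pdivrMr ?ltr_wpDl// ler_wpM2l// ?lerDl// ltW.
Unshelve. all: by end_near. Qed.

(** [Theta A iota l] is [probes l \o A]; isolating the linear factor makes the chain rule
    applicable. *)
Definition probes N (l : 'rV[E]_N) (y : Y) : 'rV[R]_N :=
  \row_i iota (l ord0 i) y.

Lemma probes_linear N (l : 'rV[E]_N) : linear (probes l).
Proof.
by move=> a x y; apply/rowP => i; rewrite !mxE; exact: embedding_linear.
Qed.

HB.instance Definition _ N (l : 'rV[E]_N) :=
  GRing.isLinear.Build R Y 'rV[R]_N *:%R (probes l) (probes_linear l).

Lemma probes_continuous N (l : 'rV[E]_N) : continuous (probes l).
Proof.
move=> y; apply: row_cvg => i; rewrite mxE.
under eq_fun do rewrite mxE.
exact: embedding_continuous.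
Qed.

Lemma Theta_C1 N (l : 'rV[E]_N) : C1_on U (Theta A iota l).
Proof.
have -> : Theta A iota l = probes l \o A by [].
exact: (C1_on_linear_comp (L := probes l) (@probes_continuous _ l) oU AC1).
Qed.

Lemma mdiff_Theta N (l : 'rV[E]_N) (X : tangent p) :
  mdiff (Theta A iota l) X = probes l (D (X c)).
Proof.
have dA : differentiable (A \o cinv c) (c p).
  apply: (AC1 cp.1).1; exists p => //; split => //; exact: cp.2.
have [_ dE] := diff_comp_at (erefl ((A \o cinv c) (c p))) dA
  (linear_differentiable (f := probes l) _ (@probes_continuous _ l)).
rewrite /mdiff -/c -[LHS]/('d (probes l \o (A \o cinv c)) (c p) (X c)) dE /=.
by rewrite diff_lin//; exact: probes_continuous.
Qed.

Definition probe_mx N (l : 'rV[E]_N) : 'M[R]_(n, N) := lin1_mx (probes l \o D).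

Lemma mul_probe_mx N (l : 'rV[E]_N) u : u *m probe_mx l = probes l (D u).
Proof. by rewrite mul_rV_lin1. Qed.

Lemma tangent_injective (W : Type) (f : 'rV[R]_n -> W) :
  injective (fun X : tangent p => f (X c)) <-> injective f.
Proof.
split=> fI => [u v fuv|X X' fX].
  rewrite -(tvecK cp u) -(tvecK cp v); congr (coords _ c).
  by apply: fI; rewrite !tvecK.
by rewrite -(coordsK cp X) -(coordsK cp X') (fI _ _ fX).
Qed.

Lemma inf_completeP N (l : 'rV[E]_N) : inf_complete p A iota l <-> row_free (probe_mx l).
Proof.
rewrite row_free_injective -tangent_injective /inf_complete.
by split=> I X X' XX'; apply: I; move: XX'; rewrite !mdiff_Theta !mul_probe_mx.
Qed.

Lemma mdiff_injectiveP : injective (@mdiff R n S Y A p) <-> injective D.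
Proof. exact: tangent_injective. Qed.

Lemma row_free_probe_mx_injective N (l : 'rV[E]_N) :
  row_free (probe_mx l) -> injective D.
Proof.
by move=> /row_free_injective MI u v uv; apply: MI; rewrite !mul_probe_mx uv.
Qed.

Hypothesis surj :
  set_surj [set: E] (subspace_dual (range (@mdiff R n S Y A p))) (restriction p A iota).

Lemma dual_basis : injective D ->
  exists e : 'I_n -> E, forall i u, iota (e i) (D u) = u ord0 i.
Proof.
move=> DI; have [k k0 kD] := injective_lower_bound DI.
have rangeD y : range (@mdiff R n S Y A p) y <-> exists u, y = D u.
  split=> [[X _ <-]|[u ->]]; first by exists (X c).
  by exists (tvec p c u) => //; rewrite /mdiff -/c tvecK.
(* The i-th coordinate on the range of [D], extended by 0. On the range [xget] returns the preimage,
   unique by injectivity. *)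
pose f i : Y -> R :=
  (fun y => (xget 0 [set u | D u = y]) ord0 i) \_ (range (@mdiff R n S Y A p)).
have fD i u : f i (D u) = u ord0 i.
  rewrite /f patchE ifT; last by rewrite inE rangeD; exists u.
  by case: xgetP => [v _ /= /DI ->|/(_ u)/=].
have fdual i : subspace_dual (range (@mdiff R n S Y A p)) (f i).
  split.
  - move=> a y z /rangeD[u ->] /rangeD[v ->].
    by rewrite -linearP !fD !mxE.
  - apply/subspace_continuousP => y /rangeD[u ->].
    apply/cvgrPdist_le => e e0.
    (* From [k * |u| <= |D u|], the coordinate functionals are Lipschitz on the range with constant
       [k^-1]. *)
    apply/nbhs_ballP; exists (k * e); first by rewrite /= mulr_gt0.
    move=> z; rewrite -ball_normE /= => uz /rangeD[v zE].
    rewrite zE in uz *; rewrite -[leLHS]/(`|f i (D u) - f i (D v)|) !fD.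
    have -> : u ord0 i - v ord0 i = (u - v) ord0 i by rewrite !mxE.
    rewrite (le_trans (coord_le_norm _ _))// -(ler_pM2l k0) (le_trans (kD _))//.
    by rewrite linearB ltW.
  - by apply/funext => y; rewrite /f !patchE; case: (y \in _).
have ef i : exists e, forall u, iota e (D u) = u ord0 i.
  have [e _ eE] := surj (fdual i); exists e => u.
  rewrite -fD -eE /restriction patchE ifT// inE rangeD.
  by exists u.
by have [e eP] := choice ef; exists e.
Qed.

Lemma exists_row_free_probe_mx N : injective D -> (n <= N)%N ->
  exists l : 'rV[E]_N, row_free (probe_mx l).
Proof.
move=> /dual_basis[e eD] nN.
(* The first n probes are the dual ones; for indices from n on, [insub] fails and the probe is 0. *)
pose l : 'rV[E]_N := \row_i oapp e 0 (insub (val i)).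
exists l; rewrite /row_free; have -> : probe_mx l = pid_mx n.
  apply/matrixP => j i; rewrite !mxE /=.
  case: insubP => [k kn kE|/negbTE].
    rewrite /= eD mxE eqxx /= -kE -(inj_eq val_inj) /= eq_sym.
    by rewrite ltn_ord andbT.
  rewrite /= => iN; have -> : (j : nat) == i = false.
    by apply/negbTE; apply: contraFneq iN => <-.
  (* Additivity at 0 forces [iota 0] to vanish, so the surplus columns are zero. *)
  have := embedding_lin_l (D (delta_mx 0 j)) 1 0 0.
  by rewrite !scale1r addr0 => /eqP; rewrite -subr_eq subrr eq_sym => /eqP.
by rewrite rank_pid_mx.
Qed.

Lemma probe_mx_row_free_leq N (l : 'rV[E]_N) : row_free (probe_mx l) -> (n <= N)%N.
Proof. by move=> /eqP <-; exact: rank_leq_col. Qed.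

(** A lower bound for the matrix at [l] survives, up to a factor 1/2, for nearby matrices, and the
    entries are continuous in the family. *)
Lemma open_complete N : open [set l : 'rV[E]_N | inf_complete p A iota l].
Proof.
rewrite openE => l /inf_completeP lfree.
have Mc (u : 'rV[R]_n) (e : R) : 0 < e ->
    \forall l' \near l, `|mulmxr (probe_mx l') u - mulmxr (probe_mx l) u| <= e.
  move=> e0; near=> l'; apply: norm_row_le => [|i]; first exact: ltW.
  rewrite /= !mul_probe_mx !mxE distrC; move: i; near: l'; apply: filter_forall => i.
  have : {for l, continuous ((iota ^~ (D u)) \o (fun l : 'rV[E]_N => l ord0 i))}.
    apply: continuous_comp; first exact: entry_continuous.
    exact: embedding_continuous_l.
  by move=> /continuous_estimate; apply.
have MI : injective (mulmxr (probe_mx l) : 'rV_n -> _) by apply/row_free_injective.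
have [k k0 kM] := injective_lower_bound (f := mulmxr (probe_mx l)) MI.
have k20 : 0 < k / 2 by rewrite divr_gt0.
have := linear_family_uniform (D := fun l => mulmxr (probe_mx l)) Mc k20.
apply: filterS => l' l'M; apply/inf_completeP/row_free_injective.
exact: (near_injective (g := mulmxr (probe_mx l')) k0 kM l'M).
Unshelve. all: by end_near. Qed.

(** The probe matrix is linear in the family, so adding a small suitable multiple of one complete
    family [l1] makes [l0] complete. *)
Lemma dense_complete N : injective D -> (n <= N)%N ->
  dense [set l : 'rV[E]_N | inf_complete p A iota l].
Proof.
move=> DI nN O [l0 Ol0] oO.
have [l1 l1free] := exists_row_free_probe_mx DI nN.
have nO : nbhs l0 O by exact: open_nbhs_nbhs.
(* Neighbourhoods of a row vector contain products of neighbourhoods of its entries, so the line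
   [l0 + t *: l1] is followed entry by entry. *)
have [P Pl0 PO] := nO.
have /filter_forall : forall i,
    \forall t \near (0 : R), P ord0 i (l0 ord0 i + t *: l1 ord0 i).
  move=> i; have : (fun t : R => l0 ord0 i + t *: l1 ord0 i) @ (0 : R) --> l0 ord0 i.
    rewrite -[X in _ --> X]addr0 -(scale0r (l1 ord0 i)).
    apply: cvgD; first exact: cvg_cst.
    by apply: cvgZr_tmp; exact: cvg_id.
  by apply; exact: Pl0.
move=> /nbhs_ballP[d d0 dP]; rewrite /= in d0.
have [t /andP[t0 td] tfree] := perturbation_row_free (probe_mx l0) l1free d0.
pose l := \row_i (l0 ord0 i + t *: l1 ord0 i) : 'rV[E]_N.
exists l; split.
  apply: PO => i j; rewrite ord1 mxE; apply: (dP t).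
  by rewrite -ball_normE /= sub0r normrN gtr0_norm.
apply/inf_completeP; suff -> : probe_mx l = probe_mx l0 + t *: probe_mx l1 by [].
apply/matrixP => j i; rewrite !mxE /= [l0 _ _ + _]addrC embedding_lin_l.
by rewrite [LHS]addrC.
Qed.

Lemma probe_number_eq : injective D -> probe_number p A iota = n%:E.
Proof.
move=> DI; rewrite /probe_number; case: pselect => [exN|[]]; last first.
  have [l lfree] := exists_row_free_probe_mx DI (leqnn n).
  by exists n; apply/asboolP; exists l; apply/inf_completeP.
case: ex_minnP => N /asboolP[l /inf_completeP lN] minN.
congr _%:E; apply/eqP; rewrite eqn_leq (probe_mx_row_free_leq lN) andbT.
have [l' l'free] := exists_row_free_probe_mx DI (leqnn n).
by apply: minN; apply/asboolP; exists l'; apply/inf_completeP.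
Qed.

End ProbeMatrix.

(** * Local charts given by C^1 maps *)

Section InverseFunction.
Context (R : realType) (n : nat) (S : manifold R n).

Lemma cinv_continuous (d : chart R n S) q :
  dom d q -> {for d q, continuous (cinv d)}.
Proof.
move=> qd; have := @continuous_cinv _ _ _ d.
rewrite continuous_open_subspace; last exact: open_cimg.
by apply; rewrite inE; exists q.
Qed.

Lemma chart_continuous (d : chart R n S) q : dom d q -> {for q, continuous d}.
Proof.
move=> qd; have := @continuous_cmap _ _ _ d.
rewrite continuous_open_subspace; last exact: open_dom.
by apply; rewrite inE.
Qed.

Lemma Ck1_subset (V W : normedModType R) (B B' : set V) (f : V -> W) :
  B' `<=` B -> Ck 1 B f -> Ck 1 B' f.
Proof. by move=> BB' [df cf]; split=> [x /BB'|v x /BB']; [exact: df|exact: cf]. Qed.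

Lemma C1_on_subset (W : normedModType R) (O O' : set S) (f : S -> W) :
  O' `<=` O -> C1_on O f -> C1_on O' f.
Proof.
move=> OO' fC1 d ad; apply: Ck1_subset (fC1 d ad).
by move=> _ [q [/OO' Oq qd] <-]; exists q.
Qed.

(** Charts are total functions, so membership in the domain is imposed explicitly. *)
Definition chart_ball (c : chart R n S) (x : 'rV[R]_n) (r : R) : set S :=
  [set q | dom c q /\ ball x r (c q)].

Lemma chart_ball_open (c : chart R n S) x r : open (chart_ball c x r).
Proof.
rewrite openE => q [qc qr]; apply: filterI.
  by apply: open_nbhs_nbhs; split => //; exact: open_dom.
apply: (chart_continuous qc); apply: open_nbhs_nbhs; split => //.
exact: ball_open.
Qed.

(** Both differentials are [mdiff f] at [q], read in two charts through linear bijections. *)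
Lemma mdiff_injective_chart (W : normedModType R) (O : set S) (f : S -> W) q c d :
  O q -> C1_on O f -> chart_around q c -> chart_around q d ->
  injective ('d (f \o cinv c) (c q)) -> injective ('d (f \o cinv d) (d q)).
Proof.
move=> Oq fC1 qc qd fI u v uv.
have dE w : 'd (f \o cinv d) (d q) w = 'd (f \o cinv c) (c q) (tvec q d w c).
  have md := etrans (mdiffE (tvec q d w) Oq fC1 qd)
    (congr1 ('d (f \o cinv d) (d q)) (tvecK qd w)).
  exact: etrans (esym md) (mdiffE (tvec q d w) Oq fC1 qc).
have {}uv := etrans (esym (dE u)) (etrans uv (dE v)).
rewrite -(tvecK qd u) -(tvecK qd v); congr (coords _ d).
by rewrite -(coordsK qc (tvec q d u)) -(coordsK qc (tvec q d v)) (fI _ _ uv).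
Qed.

(** * Inverting a map on a chart ball *)

Section LocalInverse.
Context (O : set S) (F : S -> 'rV[R]_n) (c : chart R n S) (x0 : 'rV[R]_n) (r k : R).
Let G := F \o cinv c.
Hypotheses (ac : atlas c) (k0 : 0 < k) (FC1 : C1_on O F).
Hypothesis ballO : ball x0 r `<=` c @` (O `&` dom c).
Hypothesis GI : forall x, ball x0 r x -> injective ('d G x).
Hypothesis Glow : forall x y, ball x0 r x -> ball x0 r y -> k * `|x - y| <= `|G x - G y|.
Hypothesis Gopen : open (G @` ball x0 r).

Let B := chart_ball c x0 r.

Lemma chart_ball_image : F @` B = G @` ball x0 r.
Proof.
apply/seteqP; split => [_ [q [qc qr] <-]|_ [x xr <-]].
  by exists (c q) => //=; rewrite /G /= cmapK.
have [q [Oq qc] xE] := ballO xr; exists q; last by rewrite /G /= -xE cmapK.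
by split => //; rewrite xE.
Qed.

Lemma chart_ball_subset : B `<=` O.
Proof.
move=> q [qc qr]; have [q' [Oq' q'c] qq'] := ballO qr.
by rewrite -(cmapK qc) -qq' cmapK.
Qed.

(** [Glow] makes the preimage in the ball unique; off the image, [xget] falls back to [x0]. *)
Let h (y : 'rV[R]_n) : S := cinv c (xget x0 [set x | ball x0 r x /\ G x = y]).

Lemma local_inverseK q : B q -> h (F q) = q.
Proof.
move=> [qc qr]; rewrite /h; case: xgetP => [x _ /= [xr GxF]|/(_ (c q)) /=]; last first.
  by rewrite /G /= cmapK// => -[].
have := Glow xr qr; rewrite GxF /G /= cmapK// subrr normr0 pmulr_rle0// normr_le0.
by rewrite subr_eq0 => /eqP ->; rewrite cmapK.
Qed.

Lemma chart_ball_fiber q : B q ->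
  [set q' | O q' /\ F q' = F q] `&` B = [set q].
Proof.
move=> Bq; apply/seteqP; split => [q' [[_ FE] Bq']|_ ->].
  by rewrite -(local_inverseK Bq') FE local_inverseK.
by split => //; split => //; exact: chart_ball_subset.
Qed.

(** By [Glow] the inverse read in [c] is Lipschitz, so [h] is continuous; [C1_inverse] then makes it
    C^1 in every chart of the atlas. *)
Lemma chart_ball_diffeo : C1_diffeo_on B F.
Proof.
have BO := chart_ball_subset; have FB := C1_on_subset BO FC1.
have oFB : open (F @` B) by rewrite chart_ball_image.
split => //; exists h; first exact: local_inverseK.
have hB y : (F @` B) y -> B (h y) /\ F (h y) = y.
  by move=> [q Bq <-]; rewrite local_inverseK.
have hc y : (F @` B) y -> {for y, continuous h}.
  move=> By; have [Bhy Fhy] := hB y By.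
  have chc : {for y, continuous (c \o h)}.
    apply/continuous_estimate => e e0.
    near=> z; have Bz : (F @` B) z by near: z; exact: open_nbhs_nbhs.
    have [Bhz Fhz] := hB z Bz.
    rewrite -(ler_pM2l k0); apply: (le_trans (Glow Bhy.2 Bhz.2)).
    rewrite /G /= !cmapK; [|exact: Bhz.1|exact: Bhy.1].
    rewrite Fhy Fhz; near: z; apply: cvgr_dist_le; first exact: cvg_id.
    exact: mulr_gt0.
  apply: (@near_eq_continuous _ _ (cinv c \o (c \o h))).
    near=> z; have Bz : (F @` B) z by near: z; exact: open_nbhs_nbhs.
    by rewrite /= cmapK//; exact: (hB z Bz).1.1.
  by apply: continuous_comp => //; apply: cinv_continuous; exact: Bhy.1.
split => // d ad.
have hdc y : (F @` B) y -> dom d (h y) -> {for y, continuous (d \o h)}.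
  by move=> By hyd; apply: continuous_comp; [exact: hc|exact: chart_continuous].
(* In a chart [d], the map [d \o h] inverts [F \o cinv d], whose differentials inherit injectivity
   from the chart [c]. *)
apply: (@C1_inverse _ _ (d @` (B `&` dom d)) _ (F \o cinv d)).
- by apply: chart_image_open; exact: chart_ball_open.
- rewrite openE => y [By hyd]; apply: filterI; first exact: open_nbhs_nbhs.
  by apply: (hc y By); apply: open_nbhs_nbhs; split => //; exact: open_dom.
- exact: FB.
- move=> _ [q [Bq qd] <-].
  apply: (mdiff_injective_chart Bq FB (c := c)) => //; first by split => //; exact: Bq.1.
  exact: GI Bq.2.
- move=> y [By hyd]; have [Bhy Fhy] := hB y By; split.
  + by exists (h y).
  + by rewrite /= cmapK.
  + exact: hdc.
Unshelve. all: by end_near. Qed.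

End LocalInverse.

(** The conclusion holds for all radii [s <= r], so that the ball can later be shrunk to fit the
    estimates of the Riemannian distance. *)
Lemma inverse_function (U : set S) (F : S -> 'rV[R]_n) p c :
  open U -> U p -> C1_on U F -> chart_around p c ->
  injective ('d (F \o cinv c) (c p)) ->
  exists r k K : R, [/\ 0 < r, 0 < k, 0 < K, ball (c p) r `<=` c @` (U `&` dom c) &
    (forall s, 0 < s <= r -> let B := chart_ball c (c p) s in
      [/\ open B, B p, B `<=` U, C1_diffeo_on B F &
        [set q | U q /\ F q = F p] `&` B = [set p]]) /\
    forall x y, ball (c p) r x -> ball (c p) r y ->
      k * `|x - y| <= `|(F \o cinv c) x - (F \o cinv c) y| <= K * `|x - y|].
Proof.
move=> oU Up FC1 pc; set G := F \o cinv c; set x0 := c p => GI.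
pose L : {linear 'rV[R]_n -> 'rV[R]_n} := 'd G x0.
have [k k0 kL] := injective_lower_bound (f := L) GI.
have [K K0 KL] := linear_row_bounded L.
have k20 : 0 < k / 2 by rewrite divr_gt0.
have oD : open (c @` (U `&` dom c)) by exact: chart_image_open.
have Dx0 : (c @` (U `&` dom c)) x0 by exists p => //; split => //; exact: pc.2.
have GC1 : Ck 1 (c @` (U `&` dom c)) G := FC1 c pc.1.
have nD : \forall x \near x0, (c @` (U `&` dom c)) x by exact: open_nbhs_nbhs.
have : \forall x \near x0, (c @` (U `&` dom c)) x /\
    forall u, `|'d G x u - 'd G x0 u| <= k / 2 * `|u|.
  exact: filterI nD (C1_diff_near oD Dx0 GC1 k20).
move=> /nbhs_ballP[r r0 rP].
(* On the ball the differential is within [k / 2] of [L], which leaves [k - k / 2] as lower and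
   [K + k / 2] as upper Lipschitz constant. *)
rewrite /= in r0; exists r, (k / 2), (K + k / 2).
have rD : ball x0 r `<=` c @` (U `&` dom c) by move=> x /rP[].
have Gmv x y : ball x0 r x -> ball x0 r y -> `|G x - G y - L (x - y)| <= k / 2 * `|x - y|.
  apply: row_mean_value => [|z zr]; first exact: ltW.
  by split=> [|u]; [exact: GC1.1 (rD z zr)|exact: (rP z zr).2].
have Glow x y : ball x0 r x -> ball x0 r y -> k / 2 * `|x - y| <= `|G x - G y|.
  move=> xr yr; have := near_linear_lower kL Gmv xr yr.
  by have -> : k - k / 2 = k / 2 by field.
split => //; first by rewrite addr_gt0.
split=> [s /andP[s0 sr] B|x y xr yr]; last first.
  by rewrite Glow//=; exact: (near_linear_upper KL Gmv).
have sub : ball x0 s `<=` ball x0 r by exact: le_ball.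
have sD : ball x0 s `<=` c @` (U `&` dom c) by move=> x /sub /rD.
have slow x y : ball x0 s x -> ball x0 s y -> k / 2 * `|x - y| <= `|G x - G y|.
  by move=> /sub xr /sub yr; exact: Glow.
have Bp : B p by split; [exact: pc.2|exact: ballxx].
split.
- exact: chart_ball_open.
- exact: Bp.
- exact: chart_ball_subset sD.
- apply: (chart_ball_diffeo pc.1 k20 FC1 sD _ slow).
  + by move=> x xs; exact: (near_injective (g := 'd G x) k0 kL (rP x (sub x xs)).2).
  + apply: (near_linear_open_image k0 (ltW k20) (lexx _) kL).
    by move=> x y /sub xr /sub yr; exact: Gmv.
- exact: (chart_ball_fiber k20 sD slow Bp).
Qed.

End InverseFunction.

(** * Cutoff functions and curves on the real line *)

Section OneDimension.
Context (R : realType).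

(** With [F] the primitive of [s], the function [K * F - e * phi] is nondecreasing for both signs
    [e]. Monotonicity avoids integrating the derivative of [phi], which is only bounded
    pointwise. *)
Lemma variation_le_integral (s phi : R -> R) (K : R) :
  (forall t, t \in `[0, 1] -> {for t, continuous s}) ->
  (forall t, t \in `[0, 1] -> derivable phi t 1 /\ `|phi^`()%classic t| <= K * s t) ->
  (`|phi 1 - phi 0|%:E <=
    K%:E * \int[@lebesgue_measure R]_(t in `[0%R, 1%R]) (s t)%:E)%E.
Proof.
move=> sc phid.
have swc : {within `[0, 1], continuous s}.
  by apply: continuous_in_subspaceT => t; rewrite inE /=; exact: sc.
have si : lebesgue_measure.-integrable `[0, 1] (EFin \o s).
  by apply: continuous_compact_integrable => //; exact: segment_compact.
pose F (x : R) := (\int[@lebesgue_measure R]_(t in `[0%R, x]) s t)%R.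
have F0 : F 0 = 0 by rewrite /F set_itv1 Rintegral_set1.
have Fc : {within `[0, 1], continuous F}.
  exact: parameterized_integral_continuous ler01 si.
have Fd (x : R) : x \in `]0, 1[ -> derivable F x 1 /\ F^`()%classic x = s x.
  move=> x01; have := x01; rewrite in_itv /= => /andP[x0 x1].
  apply: (continuous_FTC1_closed x1 si x0).
  by apply: sc; exact: subset_itv_oo_cc x01.
have phic : {within `[0, 1], continuous phi}.
  apply: derivable_within_continuous => t t01; exact: (phid t t01).1.
have mono (e : R) : `|e| = 1 -> e * (phi 1 - phi 0) <= K * F 1.
  move=> e1; pose H x := K * F x - e * phi x.
  have Hd (x : R) : x \in `]0, 1[ -> is_derive x 1 H (K * s x - e * phi^`()%classic x).
    move=> x01; have [dF FE] := Fd x x01.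
    have [dphi _] := phid x (subset_itv_oo_cc x01).
    have F' : is_derive x 1 F (s x).
      exact: DeriveDef dF (etrans (esym (derive1E F x)) FE).
    have phi' : is_derive x 1 phi (phi^`()%classic x).
      exact: DeriveDef dphi (esym (derive1E phi x)).
    exact: is_deriveB (is_deriveZ K F') (is_deriveZ e phi').
  have : H 0 <= H 1.
    apply: (@ger0_derive1_le_cc _ H 0 1) => //.
    - by move=> x /Hd[].
    - move=> x x01; rewrite derive1E (@derive_val _ _ _ _ _ _ _ (Hd x x01)).
      have [_ le] := phid x (subset_itv_oo_cc x01).
      rewrite subr_ge0; apply: le_trans le; apply: le_trans (ler_norm _) _.
      by rewrite normrM e1 mul1r.
    - by move=> x; exact: cvgB (cvgM (cvg_cst K) (Fc x)) (cvgM (cvg_cst e) (phic x)).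
    - by rewrite in_itv /= lexx ler01.
    - by rewrite in_itv /= lexx ler01.
  by rewrite /H F0 mulr0 mulrBr; lra.
have -> : (\int[@lebesgue_measure R]_(t in `[0%R, 1%R]) (s t)%:E)%E = (F 1)%:E.
  rewrite /F /Rintegral fineK//; apply: integrable_fin_num => //.
rewrite -EFinM lee_fin.
have := mono 1 (normr1 _); have := mono (-1) _.
rewrite normrN1 => /(_ erefl) h1 h2.
by rewrite ler_norml; lra.
Qed.

(** The square of the positive part: a C^1 function that vanishes on a half-line and has an explicit
    derivative. *)
Definition sqpos (y : R) : R := Num.max 0 y ^+ 2.

Lemma sqpos_derive (y : R) : is_derive y 1 sqpos (2 * Num.max 0 y).
Proof.
have [y0|y0|->] := ltgtP y 0.
- apply: (@near_eq_is_derive _ _ _ (cst 0)).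
    near=> z; rewrite /sqpos max_l ?expr0n//= ltW//.
    by near: z; exact: lt_nbhsl.
  by rewrite mulr0; exact: is_derive_cst.
- apply: (@near_eq_is_derive _ _ _ ((@idfun R) ^+ 2)).
    near=> z; rewrite /sqpos max_r//= ltW//.
    by near: z; exact: lt_nbhsr.
  have -> : 2 * y = (2%:R * y ^+ 2.-1) *: (1 : R) by rewrite expr1 [RHS]mulr1.
  exact: (is_deriveX 2 (is_derive_id y (1 : R))).
(* At 0, [sqpos x] is at most [|x| ^+ 2], hence at most [e * |x|] once [|x| <= e]. *)
- have [||ds dE] := @differentiable_estimate R R R^o sqpos 0 (\0 : {linear R -> R^o}).
  + by move=> x; exact: cvg_cst.
  + move=> e e0; near=> x.
    rewrite /= !subr0 /sqpos maxxx expr0n subr0 normrX expr2.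
    have h : `|Num.max 0 x| <= `|x|.
      by have [x0|x0] := leP 0 x; rewrite ?normr0.
    apply: ler_pM => //; apply: (le_trans h).
    near: x; apply/nbhs_ballP; exists e => // x.
    by rewrite -ball_normE /= sub0r normrN => /ltW.
  apply: DeriveDef; first exact: diff_derivable.
  by rewrite deriveE// dE mulr0.
Unshelve. all: by end_near. Qed.

End OneDimension.

(** * C^1 plateau and bump functions *)

Section Cutoff.
Context (R : realType).

(** A C^1 step from 0 to 1: the inner [sqpos] flattens it below 0, the outer one above 1. *)
Definition plateau (y : R) : R := 1 - sqpos (1 - sqpos y).

Lemma sqpos_ge0 (y : R) : 0 <= sqpos y.
Proof. exact: sqr_ge0. Qed.

Lemma sqpos_le0 (y : R) : y <= 0 -> sqpos y = 0.
Proof. by move=> y0; rewrite /sqpos max_l// expr0n. Qed.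

Lemma plateau_ge1 (y : R) : 1 <= y -> plateau y = 1.
Proof.
move=> y1; rewrite /plateau (@sqpos_le0 (1 - _)) ?subr0// subr_le0 /sqpos.
by rewrite max_r ?(le_trans _ y1)// exprn_ege1.
Qed.

Lemma plateau_le0 (y : R) : y <= 0 -> plateau y = 0.
Proof.
by move=> y0; rewrite /plateau (sqpos_le0 y0) subr0 /sqpos max_r// expr1n subrr.
Qed.

Lemma plateau_itv (y : R) : 0 <= plateau y <= 1.
Proof.
rewrite /plateau subr_ge0 lerBlDr lerDl sqpos_ge0 andbT.
rewrite /sqpos expr_le1// ?le_max ?lexx// ge_max ler01/= lerBlDr lerDl.
exact: sqr_ge0.
Qed.

Definition dplateau (y : R) : R := 4 * (Num.max 0 (1 - sqpos y) * Num.max 0 y).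

Lemma plateau_derive (y : R) : is_derive y 1 plateau (dplateau y).
Proof.
have d1 : is_derive y 1 (fun z => 1 - sqpos z) (- (2 * Num.max 0 y)).
  have := is_deriveB (is_derive_cst (1 : R) y (1 : R)) (sqpos_derive y).
  by rewrite sub0r.
have d2 := is_derive1_comp (g := fun z => 1 - sqpos z) (x := y)
  (sqpos_derive (1 - sqpos y)) d1.
have := is_deriveB (is_derive_cst (1 : R) y (1 : R)) d2.
by have -> : 0 - 2 * Num.max 0 (1 - sqpos y) * - (2 * Num.max 0 y) = dplateau y
  by rewrite /dplateau; ring.
Qed.

Lemma dplateau_le0 (y : R) : y <= 0 -> dplateau y = 0.
Proof. by move=> y0; rewrite /dplateau [Num.max 0 y]max_l// !mulr0. Qed.

Lemma dplateau_itv (y : R) : 0 <= dplateau y <= 4.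
Proof.
have m0 (z : R) : 0 <= Num.max 0 z by rewrite le_max lexx.
rewrite /dplateau mulr_ge0 ?mulr_ge0//= ler_piMr//.
(* For [y <= 1] both maxima are at most 1; for [y > 1] the first one vanishes. *)
have [y1|y1] := leP y 1.
  rewrite mulr_ile1//; last by rewrite ge_max ler01.
  by rewrite ge_max ler01/= lerBlDr lerDl sqpos_ge0.
rewrite max_l ?mul0r// subr_le0 /sqpos max_r; last by rewrite ltW// (lt_trans _ y1).
by rewrite exprn_ege1// ltW.
Qed.

Section Bump.
Context (n : nat) (x0 : 'rV[R]_n) (rho : R).
Hypothesis rho0 : 0 < rho.

(** The squared Euclidean distance is differentiable, unlike the sup norm of row vectors. *)
Definition sqdist (x : 'rV[R]_n) : R := \sum_i (x ord0 i - x0 ord0 i) ^+ 2.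

(** It is 1 where [sqdist x <= rho ^+ 2] and 0 where [sqdist x >= 2 * rho ^+ 2]; in the sup norm
    this gives the radii [rho / n.+1] and [2 * rho]. *)
Definition bump (x : 'rV[R]_n) : R := plateau (2 - sqdist x / rho ^+ 2).

Lemma sqr_norm_le_sqdist x : `|x - x0| ^+ 2 <= sqdist x.
Proof.
have s0 : 0 <= sqdist x by apply: sumr_ge0 => i _; exact: sqr_ge0.
rewrite -(sqr_sqrtr s0) ler_pXn2r ?nnegrE ?sqrtr_ge0//.
apply: le_trans (norm_le_euclidean _) _; rewrite ler_wsqrtr//.
by apply: ler_sum => i _; rewrite !mxE.
Qed.

Lemma bump_near x : `|x - x0| <= rho / n.+1%:R -> bump x = 1.
Proof.
move=> xr; apply: plateau_ge1.
have : sqdist x <= rho ^+ 2.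
  apply: (@le_trans _ _ (\sum_(i < n) (rho / n.+1%:R) ^+ 2)).
    apply: ler_sum => i _; rewrite -[leLHS]real_normK ?num_real//.
    rewrite ler_pXn2r ?nnegrE//; last by rewrite divr_ge0// ltW.
    by apply: le_trans xr; have := coord_le_norm (x - x0) i; rewrite !mxE.
  rewrite sumr_const card_ord -[leLHS]mulr_natr expr_div_n mulrAC.
  rewrite ler_pdivrMr ?exprn_gt0// ler_wpM2l ?sqr_ge0//.
  by rewrite -natrX ler_nat expnS expn1 (leq_trans (leqnSn n))// leq_pmulr.
by move=> h; rewrite lerBrDr -lerBrDl ler_pdivrMr ?exprn_gt0//; lra.
Qed.

Lemma sqdist_far x : 2 * rho <= `|x - x0| -> 2 - sqdist x / rho ^+ 2 <= 0.
Proof.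
move=> xr; rewrite subr_le0 ler_pdivlMr ?exprn_gt0//.
apply: le_trans (sqr_norm_le_sqdist x).
apply: (@le_trans _ _ ((2 * rho) ^+ 2)).
  by rewrite exprMn ler_wpM2r ?sqr_ge0// expr2; lra.
by rewrite ler_pXn2r ?nnegrE// mulr_ge0// ltW.
Qed.

Lemma bump_far x : 2 * rho <= `|x - x0| -> bump x = 0.
Proof. by move=> xr; apply: plateau_le0; exact: sqdist_far. Qed.

(** The product rule gives two terms, at most [|w|] and [16 * n * |w|]; the stated constant covers
    both generously. The vanishing of [d] far away serves where no lower bound on the metric is at
    hand. *)
Lemma bump_curve_derive (x : R -> 'rV[R]_n) (w : 'rV[R]_n)
    (t : R) i :
  is_derive t 1 x w ->
  exists d : R, [/\
    is_derive t 1 (fun s => bump (x s) * (x s ord0 i - x0 ord0 i)) d,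
    `|d| <= 33 * n.+1%:R * `|w| & 2 * rho <= `|x t - x0| -> d = 0].
Proof.
move=> xw.
have coordd j : is_derive t 1 (fun s => x s ord0 j - x0 ord0 j) (w ord0 j).
  have := is_deriveB (is_derive_coord j xw) (is_derive_cst (x0 ord0 j : R) t (1 : R)).
  by rewrite subr0.
pose E := \sum_j 2 * (x t ord0 j - x0 ord0 j) * w ord0 j.
have sqd : is_derive t 1 (fun s => sqdist (x s)) E.
  have -> : (fun s => sqdist (x s)) = \sum_j (fun s => x s ord0 j - x0 ord0 j) ^+ 2.
    by apply/funext => s; rewrite fct_sumE.
  exact: is_derive_sum.
pose y := 2 - sqdist (x t) / rho ^+ 2.
have yd : is_derive t 1 (fun s => 2 - sqdist (x s) / rho ^+ 2) (- (E / rho ^+ 2)).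
  have -> : (fun s => 2 - sqdist (x s) / rho ^+ 2) =
      cst 2 - rho ^- 2 \*: (fun s => sqdist (x s)).
    by apply/funext => s; congr (2 - _); exact: mulrC.
  have -> : - (E / rho ^+ 2) = 0 - rho ^- 2 *: E.
    by rewrite sub0r; congr (- _); exact: mulrC.
  exact: is_deriveB (is_derive_cst (2 : R) t (1 : R)) (is_deriveZ (rho ^- 2) sqd).
have bd := is_derive1_comp (g := fun s => 2 - sqdist (x s) / rho ^+ 2) (x := t)
  (plateau_derive y) yd.
have pd := is_deriveM bd (coordd i).
pose D := `|x t - x0|.
exists (bump (x t) * w ord0 i +
  (x t ord0 i - x0 ord0 i) * (dplateau y * - (E / rho ^+ 2))).
split.
- exact: pd.
(* For [y <= 0] the plateau and its derivative vanish; [y > 0] gives [D ^+ 2 <= 2 * rho ^+ 2], which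
   cancels the division by [rho ^+ 2]. *)
- have [y0|y0] := leP y 0.
    rewrite /bump (plateau_le0 y0) (dplateau_le0 y0) !mul0r mulr0 addr0 normr0.
    by rewrite !mulr_ge0.
  have /andP[p0 p1] := plateau_itv y; have /andP[dp0 dp1] := dplateau_itv y.
  have D2 : D ^+ 2 <= 2 * rho ^+ 2.
    apply: le_trans (sqr_norm_le_sqdist _) _.
    by move: y0; rewrite /y subr_gt0 ltr_pdivrMr ?exprn_gt0// => /ltW.
  have Dc j : `|x t ord0 j - x0 ord0 j| <= D.
    by have := coord_le_norm (x t - x0) j; rewrite !mxE.
  have EE : `|E| <= n%:R * (2 * D * `|w|).
    rewrite (le_trans (ler_norm_sum _ _ _))//.
    apply: (@le_trans _ _ (\sum_(j < n) 2 * D * `|w|)).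
      apply: ler_sum => j _; rewrite !normrM ler_pM ?mulr_ge0 ?coord_le_norm//.
      by rewrite ger0_norm// ler_wpM2l.
    by rewrite sumr_const card_ord -[leLHS]mulr_natr mulrC.
  have first : `|bump (x t) * w ord0 i| <= `|w|.
    rewrite normrM -[leRHS]mul1r ler_pM ?coord_le_norm//.
    by rewrite ger0_norm.
  have second : `|(x t ord0 i - x0 ord0 i) * (dplateau y * - (E / rho ^+ 2))| <=
      16 * n%:R * `|w|.
    have r2 : 0 <= (rho ^+ 2)^-1 by rewrite invr_ge0 sqr_ge0.
    rewrite normrM [`|dplateau y * _|]normrM normrN [`|E / _|]normrM.
    rewrite (ger0_norm r2) (ger0_norm dp0).
    apply: (@le_trans _ _ (D * (4 * (n%:R * (2 * D * `|w|) / rho ^+ 2)))).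
      have Er : 0 <= `|E| / rho ^+ 2 by apply: mulr_ge0.
      apply: ler_pM (Dc i) _ => //; first exact: mulr_ge0.
      by apply: ler_pM => //; rewrite ler_wpM2r.
    have -> : D * (4 * (n%:R * (2 * D * `|w|) / rho ^+ 2)) =
        8 * n%:R * `|w| * (D ^+ 2 / rho ^+ 2) by rewrite expr2; ring.
    have : D ^+ 2 / rho ^+ 2 <= 2 by rewrite ler_pdivrMr ?exprn_gt0.
    have nw : 0 <= 8 * n%:R * `|w| by rewrite !mulr_ge0.
    by move=> /(ler_wpM2l nw); lra.
  apply: (le_trans (ler_normD _ _)); apply: (le_trans (lerD first second)).
  rewrite -[n.+1%:R]natr1.
  have : 0 <= n%:R * `|w| by rewrite mulr_ge0.
  by have := normr_ge0 w; lra.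
- move=> far; have y0 := sqdist_far far.
  by rewrite (bump_far far) (dplateau_le0 y0) !mul0r mulr0 addr0.
Qed.

End Bump.
End Cutoff.

(** * Riemannian length and distance in a chart *)

Section MetricNorm.
Context (R : realType) (n : nat) (S : manifold R n) (g : riemannian_metric S).

Lemma tvec_linear q (c : chart R n S) : chart_around q c -> linear (@tvec R n S q c).
Proof.
move=> qc a u v; apply: (can_inj (coordsK qc)); rewrite tvecK//.
rewrite -[RHS]/(a *: (tvec q c u) c + (tvec q c v) c).
by rewrite (tvecK qc u) (tvecK qc v).
Qed.

Lemma rmetric_tvecE q c (X : tangent q) u : chart_around q c ->
  g q (tvec q c u) X = \sum_i u ord0 i * g q (tvec q c (delta_mx ord0 i)) X.
Proof.
move=> qc; pose f v : R^o := g q (tvec q c v) X.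
have fl : linear f by move=> a v w; rewrite /f tvec_linear// rmetric_linear.
pose F : {linear 'rV[R]_n -> R^o} :=
    HB.pack f (GRing.isLinear.Build R 'rV[R]_n R^o *:%R f fl).
exact: (linear_row F u).
Qed.

Definition gram (c : chart R n S) i j (x : 'rV[R]_n) : R :=
  g (cinv c x) (tvec (cinv c x) c (delta_mx ord0 i))
    (tvec (cinv c x) c (delta_mx ord0 j)).

(** The Riemannian norm in coordinates, written through the Gram matrix so that its joint continuity
    in [x] and [u] reduces to that of the entries. *)
Definition metric_norm (c : chart R n S) (x u : 'rV[R]_n) : R :=
  Num.sqrt (\sum_i u ord0 i * (\sum_j u ord0 j * gram c i j x)).

Lemma rmetric_gramE c q u : chart_around q c ->
  g q (tvec q c u) (tvec q c u) =
    \sum_i u ord0 i * (\sum_j u ord0 j * gram c i j (c q)).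
Proof.
move=> qc; rewrite /gram cmapK; last exact: qc.2.
rewrite [LHS](rmetric_tvecE _ _ qc); apply: eq_bigr => i _.
congr (_ * _); rewrite [LHS]rmetric_sym [LHS](rmetric_tvecE _ _ qc).
by apply: eq_bigr => j _; rewrite rmetric_sym.
Qed.

Lemma metric_normE c q u : chart_around q c ->
  metric_norm c (c q) u = Num.sqrt (g q (tvec q c u) (tvec q c u)).
Proof. by move=> qc; rewrite rmetric_gramE. Qed.

Lemma rmetric_ge0 q (X : tangent q) : 0 <= g q X X.
Proof.
have [->|X0] := eqVneq X 0; last by rewrite ltW// rmetric_pos.
have := @rmetric_linear _ _ _ g q 0 1 0 0.
by rewrite scaler0 addr0 mul1r => /eqP; rewrite -subr_eq subrr => /eqP <-.
Qed.

Lemma gram_continuous c q i j : chart_around q c -> {for c q, continuous (gram c i j)}.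
Proof.
move=> qc; have gs := rmetric_smooth g qc.1 (delta_mx ord0 i) (delta_mx ord0 j).
by apply: (gs 0%N); exists q => //; exact: qc.2.
Qed.

Lemma sum_continuous (T : topologicalType) m (f : 'I_m -> T -> R) t :
  (forall i, {for t, continuous (f i)}) -> {for t, continuous (fun s => \sum_i f i s)}.
Proof.
move=> fc; elim: m f fc => [|m IH] f fc.
  have -> : (fun s => \sum_(i < 0) f i s) = cst 0.
    by apply/funext => s; rewrite big_ord0.
  exact: cvg_cst.
have -> : (fun s => \sum_i f i s) =
    (fun s => f ord0 s + \sum_i f (lift ord0 i) s).
  by apply/funext => s; rewrite big_ord_recl.
by apply: continuousD; [exact: fc|exact: IH].
Qed.

Lemma metric_norm_continuous (T : topologicalType) c q (x u : T -> 'rV[R]_n) t :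
  chart_around q c -> x t = c q -> {for t, continuous x} -> {for t, continuous u} ->
  {for t, continuous (fun s => metric_norm c (x s) (u s))}.
Proof.
move=> qc xt xc uc.
have coordc i : {for t, continuous (fun s => u s ord0 i)}.
  by apply: (@continuous_comp _ _ _ u (fun v => v ord0 i)) => //; exact: coord_continuous.
apply: (@continuous_comp _ _ _ (fun s =>
  \sum_i u s ord0 i * (\sum_j u s ord0 j * gram c i j (x s))) Num.sqrt);
  last exact: sqrt_continuous.
apply: sum_continuous => i; apply: continuousM; first exact: coordc.
apply: sum_continuous => j; apply: continuousM; first exact: coordc.
by apply: (@continuous_comp _ _ _ x) => //; rewrite xt; exact: gram_continuous.
Qed.

(** Compactness gives a lower bound [a] at [c q]; nearby, the quadratic form changes by at most
    [a ^+ 2 / 2 * |u| ^+ 2]. *)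
Lemma metric_norm_bounds c q : chart_around q c ->
  exists a b : R, [/\ 0 < a, 0 < b & \forall x \near c q, forall u,
    a * `|u| <= metric_norm c x u <= b * `|u|].
Proof.
move=> qc; set x0 := c q.
pose Q x (u : 'rV[R]_n) := \sum_i u ord0 i * (\sum_j u ord0 j * gram c i j x).
have Qx0 u : 0 <= Q x0 u.
  by rewrite /Q -rmetric_gramE//; exact: rmetric_ge0.
have Nx0E u := metric_normE u qc.
have [a a0 aN] : exists2 a : R, 0 < a & forall u, a * `|u| <= metric_norm c x0 u.
  apply: homogeneous_lower_bound.
  - move=> u; apply: (@metric_norm_continuous _ c q (fun=> x0) id) => //.
    exact: cst_continuous.
  - move=> k u; rewrite -sqrtr_sqr -sqrtrM ?sqr_ge0//; congr Num.sqrt.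
    rewrite mulr_sumr; apply: eq_bigr => i _; rewrite mxE !mulr_sumr.
    by apply: eq_bigr => j _; rewrite !mxE; ring.
  - move=> u u0; rewrite Nx0E sqrtr_gt0; apply: rmetric_pos.
    apply: contra_neq u0 => tu; rewrite -(tvecK qc u) tu.
    by [].
(* The errors of the [n * n] Gram entries then add up to at most [a ^+ 2 / 2]. *)
pose e : R := a ^+ 2 / 2 / (n.+1%:R * n.+1%:R).
have e0 : 0 < e by rewrite !divr_gt0// exprn_gt0.
pose k : R := \sum_i \sum_j `|gram c i j x0|.
have k0 : 0 <= k by apply: sumr_ge0 => i _; exact: sumr_ge0.
(* The form stays above [a ^+ 2 / 2], hence above [(a / 2) ^+ 2], times [|u| ^+ 2]. Adding [a ^+ 2]
   to [k] absorbs the error and keeps the upper constant positive. *)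
exists (a / 2), (Num.sqrt (k + a ^+ 2)); split; first exact: divr_gt0.
  by rewrite sqrtr_gt0 ltr_wpDl// exprn_gt0.
have small i j : \forall x \near x0, `|gram c i j x0 - gram c i j x| <= e.
  have /continuous_estimate := gram_continuous (i := i) (j := j) qc; exact.
near=> x => u.
have sm i j : `|gram c i j x0 - gram c i j x| <= e.
  move: i j; near: x; apply: filter_forall => i; apply: filter_forall => j.
  exact: small.
have bound (h : 'I_n -> 'I_n -> R) : `|\sum_i u ord0 i * (\sum_j u ord0 j * h i j)| <=
    (\sum_i \sum_j `|h i j|) * `|u| ^+ 2.
  rewrite mulr_suml (le_trans (ler_norm_sum _ _ _))//; apply: ler_sum => i _.
  rewrite normrM expr2 mulrCA ler_pM ?coord_le_norm//.
  rewrite mulr_suml (le_trans (ler_norm_sum _ _ _))//; apply: ler_sum => j _.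
  by rewrite normrM mulrC ler_wpM2l// coord_le_norm.
have QxQ : `|Q x0 u - Q x u| <= a ^+ 2 / 2 * `|u| ^+ 2.
  have -> : Q x0 u - Q x u =
      \sum_i u ord0 i * (\sum_j u ord0 j * (gram c i j x0 - gram c i j x)).
    rewrite -sumrB; apply: eq_bigr => i _; rewrite -mulrBr -sumrB; congr (_ * _).
    by apply: eq_bigr => j _; rewrite mulrBr.
  apply: (le_trans (bound _)); rewrite ler_wpM2r ?sqr_ge0//.
  apply: (@le_trans _ _ (\sum_(i < n) \sum_(j < n) e)).
    by apply: ler_sum => i _; apply: ler_sum => j _.
  rewrite !sumr_const card_ord -mulrnA -[leLHS]mulr_natr natrM /e.
  rewrite mulrAC ler_pdivrMr ?mulr_gt0// ler_wpM2l ?divr_ge0 ?sqr_ge0//.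
  by rewrite ler_pM// ler_nat.
have Qk : `|Q x0 u| <= k * `|u| ^+ 2 by exact: bound.
have Qa : a ^+ 2 * `|u| ^+ 2 <= Q x0 u.
  rewrite -exprMn -(sqr_sqrtr (Qx0 u)) ler_pXn2r ?nnegrE//.
  by rewrite mulr_ge0// ltW.
have u2 : 0 <= `|u| ^+ 2 by exact: sqr_ge0.
have a2u : 0 <= a ^+ 2 * `|u| ^+ 2 by rewrite mulr_ge0// sqr_ge0.
move: QxQ; rewrite ler_distl => /andP[q1 q2].
have Qxlow : (a / 2) ^+ 2 * `|u| ^+ 2 <= Q x u.
  by rewrite expr_div_n; lra.
apply/andP; split.
  have au0 : 0 <= a / 2 * `|u| by rewrite mulr_ge0// divr_ge0// ltW.
  by rewrite -(ger0_norm au0) -sqrtr_sqr ler_wsqrtr// exprMn.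
have -> : `|u| = Num.sqrt (`|u| ^+ 2) by rewrite sqrtr_sqr normr_id.
rewrite -sqrtrM; last by rewrite addr_ge0// sqr_ge0.
rewrite ler_wsqrtr//; have := ler_norm (Q x0 u); rewrite mulrDl -/(Q x u).
by lra.
Unshelve. all: by end_near. Qed.

End MetricNorm.

(** * Speed of curves, and the upper bound for the distance *)

Section Speed.
Context (R : realType) (n : nat) (S : manifold R n) (g : riemannian_metric S).
Implicit Types (gamma : R -> S) (O : set R) (c : chart R n S).

Definition speed gamma (t : R) : R :=
  Num.sqrt (g (gamma t) (velocity gamma t) (velocity gamma t)).

Lemma speedE O gamma t c : O t -> @C1_into R n S R O gamma ->
  chart_around (gamma t) c ->
  speed gamma t = metric_norm g c (c (gamma t)) ((c \o gamma)^`()%classic t).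
Proof.
move=> Ot gC1 tc; rewrite (metric_normE _ _ tc) -(velocityE Ot gC1 tc).
by rewrite /speed (coordsK tc).
Qed.

Lemma curve_chart_open O gamma c t : open O -> @C1_into R n S R O gamma ->
  O t -> dom c (gamma t) -> \forall s \near t, O s /\ dom c (gamma s).
Proof.
move=> oO [gc _] Ot ct; apply: filterI; first exact: open_nbhs_nbhs.
by apply: (gc t Ot); apply: open_nbhs_nbhs; split => //; exact: open_dom.
Qed.

Lemma curve_chart_derive O gamma c t : @C1_into R n S R O gamma -> atlas c ->
  O t -> dom c (gamma t) ->
  is_derive t 1 (c \o gamma) ((c \o gamma)^`()%classic t).
Proof.
move=> [_ gC1] ac Ot ct; have [dg _] := gC1 c ac.
have dgt : differentiable (c \o gamma) t by apply: dg.
apply: DeriveDef; first exact: diff_derivable.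
by rewrite derive1E.
Qed.

(** [velocity] uses a chart that varies with the point; near [t] the speed is rewritten in one fixed
    chart. *)
Lemma speed_continuous O gamma t : open O -> @C1_into R n S R O gamma -> O t ->
  {for t, continuous (speed gamma)}.
Proof.
move=> oO gC1 Ot; pose c := chart_at (gamma t); have tc := chart_atP (gamma t).
have nc := curve_chart_open oO gC1 Ot tc.2.
apply: (@near_eq_continuous _ _
    (fun s => metric_norm g c ((c \o gamma) s) ((c \o gamma)^`()%classic s))).
  near=> s; have [Os cs] : O s /\ dom c (gamma s) by near: s.
  by rewrite (speedE Os gC1 (c := c))//; split => //; exact: tc.1.
apply: (metric_norm_continuous (x := c \o gamma) tc (erefl _)).
  by apply: continuous_comp; [exact: gC1.1|exact: chart_continuous tc.2].
have -> : (c \o gamma)^`()%classic = 'D_1 (c \o gamma).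
  by apply/funext => s; exact: derive1E.
exact: (gC1.2 c tc.1).2 1 t (conj Ot tc.2).
Unshelve. all: by end_near. Qed.

Lemma curve_speed_continuous gamma : C1_curve gamma ->
  forall t, t \in `[0, 1] -> {for t, continuous (speed gamma)}.
Proof.
by move=> [D [oD D01 gC1]] t t01; apply: (speed_continuous oD gC1); exact: D01.
Qed.

Lemma curve_length_ge0 gamma : (0 <= curve_length g gamma)%E.
Proof. by apply: integral_ge0 => t _; rewrite lee_fin sqrtr_ge0. Qed.

Lemma C1_line (V W : normedModType R) (B : set V) (f : V -> W) (y u : V) :
  open B -> Ck 1 B f ->
  @Ck R R W 1 [set t | B (y + t *: u)] (fun t : R => f (y + t *: u)).
Proof.
move=> oB [df cf].
have lc (t : R) : {for t, continuous (fun s : R => y + s *: u)}.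
  by apply: cvgD; [exact: cvg_cst|apply: cvgZr_tmp; exact: cvg_id].
have dl (t : R) : is_diff t (fun s : R => y + s *: u) (fun s : R => s *: u).
  by apply: is_diff_eq; rewrite add0r.
have dfl (t : R) : B (y + t *: u) -> differentiable (fun s : R => f (y + s *: u)) t /\
    forall v, 'd (fun s : R => f (y + s *: u)) t v = 'd f (y + t *: u) (v *: u).
  move=> Bt; have [d1 d2] := diff_comp_at (f := fun s : R => y + s *: u)
    (erefl (y + t *: u)) (@ex_diff _ _ _ _ _ _ _ (dl t)) (df _ Bt).
  split=> [|v]; first exact: d1.
  apply: etrans (congr1 (fun h => h v) d2) _ => /=.
  by rewrite (congr1 (fun h => h v) (@diff_val _ _ _ _ _ _ _ (dl t))).
split=> [t Bt|v t Bt]; first exact: (dfl t Bt).1.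
apply: (@near_eq_continuous _ _ (fun s : R => 'D_(v *: u) f (y + s *: u))).
  near=> s; have Bs : B (y + s *: u).
    by near: s; apply: (lc t); exact: open_nbhs_nbhs.
  have [d1 d2] := dfl s Bs.
  by rewrite (deriveE v d1) d2 (deriveE (v *: u) (df _ Bs)).
apply: (@continuous_comp _ _ _ (fun s : R => y + s *: u) ('D_(v *: u) f)).
  exact: lc.
exact: cf.
Unshelve. all: by end_near. Qed.

(** The chart segment from [c q1] to [c q2] is an admissible path whose speed is at most
    [b * |c q1 - c q2|]. *)
Lemma riemannian_distance_upper c x0 (r b : R) q1 q2 :
  atlas c -> ball x0 r `<=` c @` dom c -> 0 <= b ->
  (forall x u, ball x0 r x -> metric_norm g c x u <= b * `|u|) ->
  chart_ball c x0 r q1 -> chart_ball c x0 r q2 ->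
  (riemannian_distance g q1 q2 <= (b * `|c q1 - c q2|)%:E)%E.
Proof.
move=> ac rc b0 gb [q1c q1r] [q2c q2r].
pose u := c q2 - c q1.
pose l (t : R) := c q1 + t *: u.
pose gamma (t : R) := cinv c (l t).
(* [C1_curve] asks for an open set of times containing [[0, 1]]; convexity of the ball provides
   it. *)
pose O := [set t : R | ball x0 r (l t)].
have lc (t : R) : {for t, continuous l}.
  by apply: cvgD; [exact: cvg_cst|apply: cvgZr_tmp; exact: cvg_id].
have oO : open O.
  by rewrite openE => t Ot; apply: (lc t); apply: open_nbhs_nbhs; split => //;
    exact: ball_open.
have O01 : `[0, 1] `<=` O.
  by move=> t /=; rewrite in_itv /= => /andP[t0 t1]; exact: ball_segment.
have gammaO t : O t -> dom c (gamma t) /\ c (gamma t) = l t.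
  by move=> /rc[q qc qE]; rewrite /gamma -qE cmapK.
have gC1 : @C1_into R n S R O gamma.
  split=> [t Ot|d ad].
    apply: (@continuous_comp _ _ _ l (cinv c)); first exact: lc.
    have [dg gE] := gammaO t Ot; rewrite -gE; exact: cinv_continuous.
  have oI : open (c @` (dom d `&` dom c)).
    by apply: chart_image_open; exact: open_dom.
  have tC1 : Ck 1 (c @` (dom d `&` dom c)) (d \o cinv c).
    by rewrite setIC; exact: (atlas_smooth ac ad 1%N).
  (* In another chart [d], the curve is the transition map along a line. *)
  have := C1_line (c q1) u oI tC1.
  apply: Ck1_subset => t [Ot td] /=; have [dg gE] := gammaO t Ot.
  by rewrite -/(l t) -gE; exists (gamma t).
have gcurve : C1_curve gamma by exists O.
apply: (@le_trans _ _ (curve_length g gamma)).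
  apply: ereal_inf_lbound; exists [:: gamma]; last by rewrite big_seq1.
  split => //=; first by rewrite /gamma /l scale0r addr0 cmapK.
  by rewrite /gamma /l scale1r /u subrKC cmapK.
have sb t : t \in `[0, 1] -> speed gamma t <= b * `|c q1 - c q2|.
  move=> t01; have Ot : O t by exact: O01.
  have [dg gE] := gammaO t Ot.
  rewrite (speedE Ot gC1 (c := c))// distrC -/u.
  have -> : (c \o gamma)^`()%classic t = u.
    rewrite derive1E; apply: derive_val.
    apply: (@near_eq_is_derive _ _ _ l).
      near=> s; have Os : O s by near: s; exact: open_nbhs_nbhs.
      by rewrite /= (gammaO s Os).2.
    have := @is_derive_line _ _ _ idfun (c q1) u t
      (@ex_diff _ _ _ _ _ _ _ (is_diff_id _)).
    by rewrite (congr1 (fun h => h u) (@diff_val _ _ _ _ _ _ _ (is_diff_id _))).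
  by apply: gb; rewrite gE.
have mu1 : (@lebesgue_measure R `[0%R, 1%R] = 1)%E.
  by rewrite lebesgue_measure_itv /= lte_fin ltr01 oppr0 adde0.
have -> : ((b * `|c q1 - c q2|)%:E =
    \int[@lebesgue_measure R]_(t in `[0%R, 1%R]) (b * `|c q1 - c q2|)%:E)%E.
  by rewrite integral_cst//= mu1 mule1.
apply: le_integral => //.
- apply: continuous_compact_integrable; first exact: segment_compact.
  apply: continuous_in_subspaceT => t; rewrite inE /=.
  exact: curve_speed_continuous.
- apply: continuous_compact_integrable; first exact: segment_compact.
  by apply: continuous_subspaceT; exact: cst_continuous.
- by move=> t; rewrite inE /= lee_fin => /sb.
Unshelve. all: by end_near. Qed.

End Speed.

(** * Lower bound for the distance by cutoff coordinates *)

Section DistanceLowerBound.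
Context (R : realType) (n : nat) (S : manifold R n) (g : riemannian_metric S).
Context (c : chart R n S) (x0 : 'rV[R]_n) (rho a : R).
Hypotheses (ac : atlas c) (rho0 : 0 < rho) (a0 : 0 < a).
Hypothesis corec : [set x | `|x0 - x| <= 2 * rho] `<=` c @` dom c.
Hypothesis ga : forall x u, `|x0 - x| <= 2 * rho -> a * `|u| <= metric_norm g c x u.

(** The constant of [bump_curve_derive] divided by the lower bound [a] of the metric. *)
Let K : R := 33 * n.+1%:R / a.

Definition cutoff_coord i (q : S) : R :=
  if `[< dom c q >] then bump x0 rho (c q) * (c q ord0 i - x0 ord0 i) else 0.

(** A compact set in a Hausdorff space is closed. Hence a curve outside the chart domain stays off
    the core for nearby times, where the cutoff coordinates vanish. *)
Lemma core_closed : closed (cinv c @` [set x | `|x0 - x| <= 2 * rho]).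
Proof.
apply: compact_closed; first exact: manifold_hausdorff.
apply: continuous_compact; last exact: compact_rV_ball.
apply: continuous_in_subspaceT => x; rewrite inE => /corec[q qc <-].
exact: cinv_continuous.
Qed.

(** Three cases: outside the chart the function is locally 0 along the curve; in the chart but far
    from [x0] the derivative is 0; in the core the metric bound [ga] compares [|w|] with the
    speed. *)
Lemma cutoff_coord_derive D gamma (t : R) i :
  open D -> @C1_into R n S R D gamma -> D t ->
  exists2 d : R, is_derive t 1 (cutoff_coord i \o gamma) d &
    `|d| <= K * speed g gamma t.
Proof.
move=> oD gC1 Dt.
have K0 : 0 <= K by rewrite divr_ge0 ?mulr_ge0// ltW.
have Ks0 : 0 <= K * speed g gamma t by rewrite mulr_ge0// sqrtr_ge0.
have [ct|nct] := pselect (dom c (gamma t)); last first.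
  exists 0; last by rewrite normr0.
  apply: (@near_eq_is_derive _ _ _ (cst 0)).
  have nK : ~ (cinv c @` [set x | `|x0 - x| <= 2 * rho]) (gamma t).
    by move=> [x /corec[q qc <-] /=]; rewrite cmapK// => qE; apply: nct; rewrite -qE.
  have := core_closed; rewrite -openC => oK.
  have : \forall s \near t, (~` (cinv c @` [set x | `|x0 - x| <= 2 * rho])) (gamma s).
    by apply: (gC1.1 t Dt); exact: open_nbhs_nbhs.
  apply: filterS => s sK; rewrite /cst /= /cutoff_coord.
  case: asboolP => // cs; rewrite bump_far ?mul0r// leNgt; apply/negP => far.
  apply: sK; exists (c (gamma s)); last by rewrite cmapK.
  by rewrite /= distrC ltW.
have [d [dd dle dfar]] := bump_curve_derive x0 rho0 i (curve_chart_derive gC1 ac Dt ct).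
exists d.
  apply: near_eq_is_derive dd; have := curve_chart_open oD gC1 Dt ct.
  by apply: filterS => s [_ cs]; rewrite /= /cutoff_coord asboolT.
have [far|near] := leP (2 * rho) `|(c \o gamma) t - x0|.
  by rewrite (dfar far) normr0.
apply: (le_trans dle); rewrite /K -[leRHS]mulrA ler_wpM2l ?mulr_ge0//.
rewrite ler_pdivlMl// (speedE g Dt gC1 (c := c))//.
by apply: ga; rewrite distrC ltW.
Qed.

Lemma cutoff_coord_curve gamma i : C1_curve gamma ->
  (`|cutoff_coord i (gamma 1) - cutoff_coord i (gamma 0)|%:E <=
    K%:E * curve_length g gamma)%E.
Proof.
move=> gC; have [D [oD D01 gC1]] := gC.
apply: (@variation_le_integral _ (speed g gamma) (cutoff_coord i \o gamma) K).
  exact: curve_speed_continuous.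
move=> t t01; have [d dd dle] := cutoff_coord_derive i oD gC1 (D01 t t01).
split; first by case: dd.
by rewrite derive1E (@derive_val _ _ _ _ _ _ _ dd).
Qed.

Lemma cutoff_coord_path q gs q' i : piecewise_C1_path q gs q' ->
  (`|cutoff_coord i q' - cutoff_coord i q|%:E <=
    K%:E * \sum_(gamma <- gs) curve_length g gamma)%E.
Proof.
elim: gs q => [|gamma gs IH] q /=.
  by move=> ->; rewrite big_nil subrr normr0 mule0.
move=> [gC <- path]; rewrite big_cons ge0_muleDr; first last.
- by apply: sume_ge0 => h _; exact: curve_length_ge0.
- exact: curve_length_ge0.
apply: le_trans (leeD (cutoff_coord_curve i gC) (IH _ path)).
by rewrite -EFinD lee_fin [leRHS]addrC ler_distD.
Qed.

(** On the small ball the cutoff is 1, so increments of cutoff coordinates are increments of chart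
    coordinates, and the sup norm is read off coordinatewise. *)
Lemma riemannian_distance_lower q1 q2 :
  chart_ball c x0 (rho / n.+1%:R) q1 -> chart_ball c x0 (rho / n.+1%:R) q2 ->
  (`|c q1 - c q2|%:E <= K%:E * riemannian_distance g q1 q2)%E.
Proof.
move=> [q1c q1r] [q2c q2r].
have K0 : 0 < K by rewrite divr_gt0.
have cutE q i : dom c q -> ball x0 (rho / n.+1%:R) (c q) ->
    cutoff_coord i q = c q ord0 i - x0 ord0 i.
  move=> qc; rewrite -ball_normE /= distrC => qr.
  by rewrite /cutoff_coord asboolT// bump_near ?mul1r// ltW.
rewrite -lee_pdivrMl//; apply/ereal_infP => _ [gs path <-].
rewrite lee_pdivrMl//.
have pathl i := cutoff_coord_path i path.
set s := (K%:E * _)%E in pathl *.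
have : (0 <= s)%E.
  apply: mule_ge0; first by rewrite lee_fin ltW.
  by apply: sume_ge0 => h _; exact: curve_length_ge0.
(* An infinite value makes the bound trivial; [-oo] is excluded by nonnegativity. *)
case: s pathl => [s||] // pathl s0; last by rewrite leey.
rewrite lee_fin in s0 *; apply: norm_row_le => // i.
have := pathl i; rewrite lee_fin !cutE// distrC.
by rewrite opprB addrA subrK !mxE.
Qed.

End DistanceLowerBound.

(** * Bi-Lipschitz charts *)

Section BiLipschitz.
Context (R : realType) (n : nat) (S : manifold R n) (g : riemannian_metric S).

Lemma riemannian_distance_chart (c : chart R n S) p : chart_around p c ->
  exists2 r : R, 0 < r & forall s, 0 < s <= r ->
    exists a b : R, [/\ 0 < a, 0 < b & forall q1 q2,
      chart_ball c (c p) (s / (4 * n.+1%:R)) q1 ->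
      chart_ball c (c p) (s / (4 * n.+1%:R)) q2 ->
      (`|c q1 - c q2|%:E <= a%:E * riemannian_distance g q1 q2)%E /\
      (riemannian_distance g q1 q2 <= (b * `|c q1 - c q2|)%:E)%E].
Proof.
move=> pc; have [a [b [a0 b0 /nbhs_ballP[r1 r10 bounds]]]] := metric_norm_bounds g pc.
have /nbhs_ballP[r2 r20 cball] : \forall x \near c p, (c @` dom c) x.
  by apply: open_nbhs_nbhs; split; [exact: open_cimg|exists p => //; exact: pc.2].
rewrite /= in r10 r20; exists (Num.min r1 r2); first by rewrite lt_min r10.
move=> s /andP[s0]; rewrite le_min => /andP[s1 s2].
(* With cutoff radius [s / 4], the core of radius [s / 2] lies in the ball of radius [s]. *)
have rho0 : 0 < s / 4 by rewrite divr_gt0.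
have core x : `|c p - x| <= 2 * (s / 4) -> ball (c p) s x.
  by move=> xs; rewrite -ball_normE /=; lra.
have rE : s / (4 * n.+1%:R) = s / 4 / n.+1%:R by rewrite invfM mulrA.
have rs : s / (4 * n.+1%:R) <= s.
  by rewrite ler_pdivrMr// ler_peMr ?(ltW s0)// -natrM ler1n.
exists (33 * n.+1%:R / a), b; split => //; first by rewrite divr_gt0// mulr_gt0.
move=> q1 q2 Bq1 Bq2; split.
  rewrite rE in Bq1 Bq2.
  apply: (@riemannian_distance_lower _ _ _ g c (c p) (s / 4)) => //.
  - exact: pc.1.
  - by move=> x /core /(le_ball s2) /cball.
  - by move=> x u /core /(le_ball s1) /bounds /(_ u) /andP[].
apply: (@riemannian_distance_upper _ _ _ g c (c p) (s / (4 * n.+1%:R))) => //.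
- exact: pc.1.
- by move=> x /(le_ball (le_trans rs s2)) /cball.
- exact: ltW.
- by move=> x u /(le_ball (le_trans rs s1)) /bounds /(_ u) /andP[].
Qed.

Lemma bilipschitz_chart (U : set S) (F : S -> 'rV[R]_n) (c : chart R n S) p :
  open U -> U p -> C1_on U F -> chart_around p c ->
  injective ('d (F \o cinv c) (c p)) ->
  exists U0 : set S, [/\ open U0, U0 p, U0 `<=` U,
    [set q | U q /\ F q = F p] `&` U0 = [set p] & C1_diffeo_on U0 F /\
    exists k k' : R, [/\ 0 < k, k <= k' & forall p1 p2, U0 p1 -> U0 p2 ->
      (k%:E * riemannian_distance g p1 p2 <= (euclidean_norm (F p1 - F p2))%:E)%E /\
      ((euclidean_norm (F p1 - F p2))%:E <= k'%:E * riemannian_distance g p1 p2)%E]].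
Proof.
move=> oU Up FC1 pc FI.
have [r [k [K [r0 k0 K0 rD [diffeo Flip]]]]] := inverse_function oU Up FC1 pc FI.
have [r1 r10 dist] := riemannian_distance_chart pc.
pose s := Num.min r r1.
have s0 : 0 < s by rewrite lt_min r0.
have [a [b [a0 b0 ab]]] : exists a b : R, [/\ 0 < a, 0 < b & forall q1 q2,
      chart_ball c (c p) (s / (4 * n.+1%:R)) q1 ->
      chart_ball c (c p) (s / (4 * n.+1%:R)) q2 ->
      (`|c q1 - c q2|%:E <= a%:E * riemannian_distance g q1 q2)%E /\
      (riemannian_distance g q1 q2 <= (b * `|c q1 - c q2|)%:E)%E].
  by apply: dist; rewrite s0 ge_min lexx orbT.
set t := s / _ in ab.
have t0 : 0 < t by rewrite divr_gt0// mulr_gt0.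
have tr : t <= r.
  apply: (@le_trans _ _ s); last by rewrite ge_min lexx.
  by rewrite ler_pdivrMr// ler_peMr ?(ltW s0)// -natrM ler1n.
have ttr : 0 < t <= r by rewrite t0.
have [oB Bp BU BF fib] := diffeo t ttr.
exists (chart_ball c (c p) t); split => //; split => //.
have kb0 : 0 < k / b by rewrite divr_gt0.
have nKa0 : 0 < n.+1%:R * K * a by rewrite !mulr_gt0.
(* The lower constant combines [k] for [F] with [b] for the distance, and [n.+1 * K * a] bounds from
   above; adding [k / b] to it orders the two constants. *)
exists (k / b), (k / b + n.+1%:R * K * a); split => //; first by rewrite lerDl ltW.
move=> p1 p2 B1 B2; have [lo up] := ab p1 p2 B1 B2.
have := Flip _ _ (le_ball tr B1.2) (le_ball tr B2.2).
rewrite /= !cmapK; [|exact: B2.1|exact: B1.1] => /andP[Flo Fup].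
have eu1 := norm_le_euclidean (F p1 - F p2).
have eu2 := euclidean_le_norm (F p1 - F p2).
have d0 : (0 <= riemannian_distance g p1 p2)%E.
  apply/ereal_infP => _ [gs _ <-].
  by apply: sume_ge0 => h _; exact: curve_length_ge0.
split.
  apply: (@le_trans _ _ ((k / b)%:E * (b * `|c p1 - c p2|)%:E)%E).
    by apply: lee_wpmul2l => //; rewrite lee_fin ltW.
  rewrite -EFinM lee_fin mulrA divfK ?gt_eqF//.
  exact: le_trans Flo eu1.
apply: (@le_trans _ _ ((n.+1%:R * K * a)%:E * riemannian_distance g p1 p2)%E); last first.
  by apply: lee_wpmul2r => //; rewrite lee_fin lerDr ltW.
rewrite EFinM -muleA.
apply: (@le_trans _ _ ((n.+1%:R * K)%:E * `|c p1 - c p2|%:E)%E).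
  rewrite -EFinM lee_fin -mulrA; apply: le_trans eu2 _.
  by rewrite ler_wpM2l.
by apply: lee_wpmul2l => //; rewrite lee_fin mulr_ge0// ltW.
Qed.

End BiLipschitz.

Unset Implicit Arguments.
Set Strict Implicit.
Set Printing Implicit Defensive.

Theorem theorem7p3 (R : realType) (n : nat) (S : manifold R n) (p : S)
    (U : set S) (Y E : completeNormedModType R) (A : S -> Y)
    (iota : E -> Y -> R)
    (m := \dim {: tangent p})
    (L := mdiff A (q := p) : tangent p -> Y)
    (complete := fun N (l : 'rV[E]_N) => inf_complete p A iota l)
    (C := fun N => [set l : 'rV[E]_N | complete N l]) :
  open U -> U p -> C1_on U A -> dual_embedding iota ->
  set_surj [set: E] (subspace_dual (range L)) (restriction p A iota) ->
  [/\ (exists (N : nat) (l : 'rV[E]_N), complete N l) <-> injective L,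
      injective L ->
        probe_number p A iota = m%:E /\
        (m = 0%N ->
          (forall l : 'rV[E]_0, complete 0%N l) /\
          probe_number p A iota = 0%N%:E),
      injective L -> forall N, (m <= N)%N -> open (C N) /\ dense (C N),
      (1 <= m)%N -> forall l : 'rV[E]_m, C m l ->
        local_C1_diffeo_at U (Theta A iota l) p /\
        exists U0 : set S, [/\ open U0, U0 p, U0 `<=` U &
          [set q | U q /\ Theta A iota l q = Theta A iota l p] `&` U0 = [set p]]
    & forall g : riemannian_metric S,
        (1 <= m)%N -> forall l : 'rV[E]_m, C m l ->
        exists U0 : set S, [/\ open U0, U0 p, U0 `<=` U,
          [set q | U q /\ Theta A iota l q = Theta A iota l p] `&` U0 = [set p]
          & C1_diffeo_on U0 (Theta A iota l) /\
            exists c c' : R, [/\ 0 < c, c <= c' & forall p1 p2, U0 p1 -> U0 p2 ->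
              (c%:E * riemannian_distance g p1 p2 <=
                 (euclidean_norm (Theta A iota l p1 - Theta A iota l p2))%:E)%E /\
              ((euclidean_norm (Theta A iota l p1 - Theta A iota l p2))%:E <=
                 c'%:E * riemannian_distance g p1 p2)%E]]].
Proof.
move=> oU Up AC1 iotaP surj.
have LD := mdiff_injectiveP p A : injective L <-> _.
have mn : m = n := dim_tangent p.
(* Replacing [m] by [n] identifies the target of the square families with the space of chart
   coordinates. *)
rewrite -/complete; clearbody m; subst m.
have existsP N : injective L -> (n <= N)%N -> exists l : 'rV[E]_N, complete N l.
  move=> /LD DI nN; have [l lP] := exists_row_free_probe_mx iotaP surj DI nN.
  by exists l; apply/(inf_completeP Up AC1 iotaP).
split.
- split=> [[N [l /(inf_completeP Up AC1 iotaP)/row_free_probe_mx_injective DI]]|LI].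
    by apply/LD; exact: DI.
  by exists n; exact: existsP.
- move=> LI; have pn := probe_number_eq Up AC1 iotaP surj (LD.1 LI).
  split=> // n0; rewrite pn n0; split=> // l; apply/(inf_completeP Up AC1 iotaP).
  (* A matrix with no rows is row free. *)
  by rewrite /row_free eqn_leq rank_leq_row (leq_trans (eq_leq n0)).
- move=> LI N nN; split; first exact: open_complete Up AC1 iotaP _.
  exact: dense_complete Up AC1 iotaP surj _ (LD.1 LI) nN.
(* Completeness is turned into injectivity of the differential of [Theta A iota l] read in the chart
   at [p]. *)
- move=> _ l /(tangent_injective p) lI.
  have FC1 : C1_on U (Theta A iota l) by exact: Theta_C1.
  have [r [k [K [r0 _ _ _ [diffeo _]]]]] :=
    inverse_function oU Up FC1 (chart_atP p) lI.
  have [|oB Bp BU BF fib] := diffeo r; first by rewrite r0 lexx.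
  by split; exists (chart_ball (chart_at p) (chart_at p p) r).
- move=> g _ l /(tangent_injective p) lI.
  have FC1 : C1_on U (Theta A iota l) by exact: Theta_C1.
  exact: bilipschitz_chart oU Up FC1 (chart_atP p) lI.
Qed.
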